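(* Let $\{\mathbf{x}^{(k)}\}_{k\ge 1}$ be the sequence generated by the Pairwise Stochastic Frank-Wolfe algorithm (PSFW, described in the context) for solving $\min_{\mathbf{x}\in\mathcal{P}}F(\mathbf{x})$, $F=\frac1n\sum_{i=1}^n f_i$. Let $N$ be the number of vertices used to represent the iterates ($N=p+1$ if the representation update uses Carathéodory's theorem, otherwise $N=|V|$), and let $F^*=\min_{\mathbf{x}\in\mathcal{P}}F(\mathbf{x})$. Let $$\kappa=\min\Big\{\tfrac12,\ \frac{\Omega_{\mathcal{P}}^2\,\sigma_F}{8N^2L_FD^2}\Big\},\qquad \sigma_F=\min\{\sigma_1,\dots,\sigma_n\},\quad L_F=\max\{L_1,\dots,L_n\},$$ and let the batch sizes be $m^{(i)}=\lceil 1/(1-\kappa)^{2i+2}\rceil$. Then there exist a deterministic constant $C_3$ and a number $\phi$ with $0<\phi<\kappa\le 1/2$ such that for every $k\ge1$ $$\mathbb{E}\{F(\mathbf{x}^{(k+1)})-F^*\}\le C_3(1-\phi)^{k/(3|V|!+1)}.$$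
   Context: Problem. $\mathcal{P}=\{\mathbf{x}\in\mathbb{R}^p:\mathbf{C}\mathbf{x}\le\mathbf{d}\}$, with $\mathbf{C}\in\mathbb{R}^{m\times p}$ (rows $\mathbf{C}_i$) and $\mathbf{d}\in\mathbb{R}^m$, is a non-empty compact polyhedron with more than one point; $V$ is its finite set of vertices ($|V|!$ is the factorial of $|V|$), $D=\sup\{\|\mathbf{x}-\mathbf{y}\|:\mathbf{x},\mathbf{y}\in\mathcal{P}\}$ its diameter. For $i=1,\dots,n$, $f_i:\mathbb{R}^p\to\mathbb{R}$ is strongly convex with parameter $\sigma_i>0$ and differentiable with $L_i$-Lipschitz gradient. $F=\frac1n\sum_{i=1}^n f_i$. $\xi$ is uniform on $\{1,\dots,n\}$ and $f(i,\mathbf{x})=f_i(\mathbf{x})$. Constant $\Omega_{\mathcal{P}}=\zeta_0/\phi_0$, where $\zeta_0=\min\{d_i-\mathbf{C}_i\mathbf{v}:\mathbf{v}\in V,\ i\in\{1,\dots,m\},\ d_i>\mathbf{C}_i\mathbf{v}\}$ and $\phi_0=\max_{i\in\{1,\dots,m\}\setminus I(V)}\|\mathbf{C}_i\|$, with $I(V)=\{i:\mathbf{C}_i\mathbf{v}=d_i\text{ for all }\mathbf{v}\in V\}$. PSFW. Start from $\mathbf{x}^{(1)}\in V$, with weights $\mu^{(1)}_{\mathbf{x}^{(1)}}=1$, $\mu^{(1)}_{\mathbf{v}}=0$ for other $\mathbf{v}\in V$, and $U^{(1)}=\{\mathbf{x}^{(1)}\}$. At iteration $k=1,2,\dots$: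 (1) Draw $\xi_1,\dots,\xi_{m^{(k)}}$ i.i.d. copies of $\xi$ (independent of the past); set $F^{(k)}(\mathbf{x})=\frac1{m^{(k)}}\sum_{i=1}^{m^{(k)}}f(\xi_i,\mathbf{x})$, $\mathbf{g}^{(k)}=\nabla F^{(k)}(\mathbf{x}^{(k)})$, $L^{(k)}=\frac1{m^{(k)}}\sum_{i=1}^{m^{(k)}}L_{\xi_i}$. (2) Choose a vertex $\mathbf{p}^{(k)}\in\arg\min_{\mathbf{x}\in\mathcal{P}}\langle\mathbf{g}^{(k)},\mathbf{x}\rangle$ and $\mathbf{u}^{(k)}\in\arg\max_{\mathbf{v}\in U^{(k)}}\langle\mathbf{g}^{(k)},\mathbf{v}\rangle$. (3) Set $\mathbf{d}^{(k)}=\mathbf{p}^{(k)}-\mathbf{u}^{(k)}$ and $\gamma^{(k)}_{\max}=\mu^{(k)}_{\mathbf{u}^{(k)}}$. (4) Set $\gamma^{(k)}=\min\{-\langle\mathbf{g}^{(k)},\mathbf{d}^{(k)}\rangle/(L^{(k)}\|\mathbf{d}^{(k)}\|^2),\gamma^{(k)}_{\max}\}$ (with $\gamma^{(k)}=0$ if $\mathbf{d}^{(k)}=0$), or determine it by line search, $\gamma^{(k)}\in\arg\min_{0\le\gamma\le\gamma^{(k)}_{\max}}F^{(k)}(\mathbf{x}^{(k)}+\gamma\mathbf{d}^{(k)})$. Set $\mathbf{x}^{(k+1)}=\mathbf{x}^{(k)}+\gamma^{(k)}\mathbf{d}^{(k)}$. (5) Representation update: move weight $\gamma^{(k)}$ from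 $\mathbf{u}^{(k)}$ to $\mathbf{p}^{(k)}$, i.e. $\mu^{(k+1)}$ equals $\mu^{(k)}$ with $\gamma^{(k)}$ subtracted from the weight of $\mathbf{u}^{(k)}$ and added to the weight of $\mathbf{p}^{(k)}$; $U^{(k+1)}=\{\mathbf{v}\in V:\mu^{(k+1)}_{\mathbf{v}}>0\}$. Optionally, Carathéodory's theorem is then applied to replace this representation $\mathbf{x}^{(k+1)}=\sum_{\mathbf{v}\in U^{(k+1)}}\mu^{(k+1)}_{\mathbf{v}}\mathbf{v}$ by one using a subset of at most $p+1$ of these vertices. *)

(* Defs.v *)
From HB Require Import structures.
From mathcomp Require Import all_boot all_order all_algebra finmap.
From mathcomp Require Import all_classical all_reals all_analysis.

Set Implicit Arguments.
Unset Strict Implicit.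
Unset Printing Implicit Defensive.

Import Order.TTheory GRing.Theory Num.Theory.
Import numFieldNormedType.Exports.

Local Open Scope classical_set_scope.
Local Open Scope ring_scope.

Section euclidean.
Context {R : realType} {p : nat}.
Implicit Types (x y : 'cV[R]_p) (f : 'cV[R]_p -> R).

Definition dot x y : R := \sum_(i < p) x i ord0 * y i ord0.

(* The library norm `|x| on matrices is the sup norm. It induces the same
   topology, so [compact] and [differentiable] refer to the usual notions, but
   lengths have to be measured with the Euclidean norm. *)
Definition enorm x : R := Num.sqrt (dot x x).

Definition grad f x : 'cV[R]_p := \col_(i < p) 'D_(delta_mx i ord0) f x.

Definition lipschitz_grad (L : R) f : Prop :=
  forall x y, enorm (grad f x - grad f y) <= L * enorm (x - y).

Definition strongly_convex (s : R) f : Prop :=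
  forall x y (a : R), 0 <= a <= 1 ->
    f (a *: x + (1 - a) *: y) <=
      a * f x + (1 - a) * f y - s / 2 * a * (1 - a) * enorm (x - y) ^+ 2.

End euclidean.

Section polyhedron.
Context {R : realType} {m p : nat}.
Variables (C : 'M[R]_(m, p)) (d : 'cV[R]_m).

Definition polyhedron : set 'cV[R]_p :=
  [set x | forall i : 'I_m, (C *m x) i ord0 <= d i ord0].

(* vertices as extreme points *)
Definition vertices : set 'cV[R]_p :=
  [set x | polyhedron x /\
     forall y z (a : R), polyhedron y -> polyhedron z -> 0 < a < 1 ->
       x = a *: y + (1 - a) *: z -> y = z].

(* [fset_set] is meaningful since a polyhedron has finitely many vertices. *)
Definition nb_vertices : nat := #|` fset_set vertices|.

Definition diameter : R :=
  sup [set r | exists x y, [/\ polyhedron x, polyhedron y & r = enorm (x - y)]].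

Definition always_active : set 'I_m :=
  [set i | forall v, vertices v -> (C *m v) i ord0 = d i ord0].

(* [inf] and [sup] of nonempty finite sets of reals, i.e. min and max, as soon
   as the polyhedron is compact and has more than one point *)
Definition zeta0 : R :=
  inf [set r | exists v i, [/\ vertices v, (C *m v) i ord0 < d i ord0 &
                               r = d i ord0 - (C *m v) i ord0]].

Definition phi0 : R := sup [set enorm (row i C)^T | i in ~` always_active].

Definition Omega : R := zeta0 / phi0.

End polyhedron.

Section problem.
Context {R : realType} {m p n : nat}.
Variables (C : 'M[R]_(m, p)) (d : 'cV[R]_m).
Variables (f : 'I_n -> 'cV[R]_p -> R) (sigma L : 'I_n -> R).
(* whether the representation update uses Caratheodory's theorem *)
Variable caratheodory : bool.

Definition objective (x : 'cV[R]_p) : R := n%:R^-1 * \sum_(i < n) f i x.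

Definition optimum : R := inf [set objective x | x in polyhedron C d].

(* min and max: the index set is finite (and nonempty when 0 < n) *)
Definition sigmaF : R := inf (range sigma).
Definition LF : R := sup (range L).

Definition rep_size : nat := if caratheodory then p.+1 else nb_vertices C d.

Definition kappa : R :=
  Num.min 2^-1
    (Omega C d ^+ 2 * sigmaF /
       (8 * rep_size%:R ^+ 2 * LF * diameter C d ^+ 2)).

Definition batch_size (k : nat) : nat :=
  `|Num.ceil (((1 - kappa) ^+ (2 * k + 2))^-1)|%N.

Section batch.
Variables (b : nat) (s : nat -> 'I_n).

Definition batch_fun (x : 'cV[R]_p) : R := b%:R^-1 * \sum_(j < b) f (s j) x.
Definition batch_lip : R := b%:R^-1 * \sum_(j < b) L (s j).

End batch.

(* U^(k): the vertices carrying positive weight *)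
Definition active (mu : 'cV[R]_p -> R) : set 'cV[R]_p :=
  [set v | vertices C d v /\ 0 < mu v].

Definition short_step (b : nat) (s : nat -> 'I_n) (g dir : 'cV[R]_p)
    (gmax : R) : R :=
  if dir == 0 then 0
  else Num.min (- dot g dir / (batch_lip b s * enorm dir ^+ 2)) gmax.

Definition line_search (h : 'cV[R]_p -> R) (x dir : 'cV[R]_p)
    (gmax gam : R) : Prop :=
  0 <= gam <= gmax /\
  forall a, 0 <= a <= gmax -> h (x + gam *: dir) <= h (x + a *: dir).

Definition move_weight (mu : 'cV[R]_p -> R) (pv uv : 'cV[R]_p) (gam : R) :
    'cV[R]_p -> R :=
  fun v => mu v - gam * (v == uv)%:R + gam * (v == pv)%:R.

(* mu' represents x as a convex combination of at most p + 1 of the vertices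
   active in mu. *)
Definition caratheodory_rep (x : 'cV[R]_p) (mu mu' : 'cV[R]_p -> R) : Prop :=
  [/\ forall v, vertices C d v -> 0 <= mu' v,
      \sum_(v \in vertices C d) mu' v = 1,
      \sum_(v \in vertices C d) mu' v *: v = x,
      active mu' `<=` active mu &
      (active mu' #<= `I_p.+1)%card].

(* One iteration along a fixed outcome: [s] is the sample of size [b],
   ([x], [mu]) and ([x'], [mu']) are the iterate and its weights before and
   after. Weights are only constrained on the vertices. *)
Definition psfw_step (b : nat) (s : nat -> 'I_n)
    (x : 'cV[R]_p) (mu : 'cV[R]_p -> R) (pv uv : 'cV[R]_p) (gam : R)
    (x' : 'cV[R]_p) (mu' : 'cV[R]_p -> R) : Prop :=
  let g := grad (batch_fun b s) x in
  let dir := pv - uv in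
  let gmax := mu uv in
  let mu1 := move_weight mu pv uv gam in
  [/\ vertices C d pv /\ (forall y, polyhedron C d y -> dot g pv <= dot g y),
      active mu uv /\ (forall v, active mu v -> dot g v <= dot g uv),
      gam = short_step b s g dir gmax \/
        line_search (batch_fun b s) x dir gmax gam,
      x' = x + gam *: dir &
      if caratheodory then caratheodory_rep x' mu1 mu'
      else forall v, vertices C d v -> mu' v = mu1 v].

Section run.
Context {disp : measure_display} {T : measurableType disp}.
Variables (Pr : probability T R).
Variable G : nat -> set (set T).
Variables (xi : nat -> nat -> T -> 'I_n).
Variables (x : nat -> T -> 'cV[R]_p) (mu : nat -> T -> 'cV[R]_p -> R).
Variables (pv uv : nat -> T -> 'cV[R]_p) (gam : nat -> T -> R).

Definition filtration : Prop :=
  forall k, [/\ sigma_algebra setT (G k), G k `<=` measurable &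
                G k `<=` G k.+1].

Definition real_measurable_wrt (H : set (set T)) (X : T -> R) : Prop :=
  forall B : set R, measurable B -> H (X @^-1` B).

Definition vec_measurable_wrt (H : set (set T)) (X : T -> 'cV[R]_p) : Prop :=
  forall i, real_measurable_wrt H (fun t => X t i ord0).

(* G k is the past of iteration k: it contains the information on the k-th
   iterate and its weights, and on all draws and choices made before. *)
Definition adapted : Prop :=
  forall k, (0 < k)%N ->
  [/\ vec_measurable_wrt (G k) (x k) /\
        (forall v, vertices C d v ->
           real_measurable_wrt (G k) (fun t => mu k t v)),
      forall j (i : 'I_n), (j < batch_size k)%N ->
        G k.+1 (xi k j @^-1` [set i]),
      vec_measurable_wrt (G k.+1) (pv k),
      vec_measurable_wrt (G k.+1) (uv k) &
      real_measurable_wrt (G k.+1) (gam k)].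

Definition uniform_draws : Prop :=
  forall k j (i : 'I_n), (0 < k)%N -> (j < batch_size k)%N ->
    Pr (xi k j @^-1` [set i]) = (n%:R^-1)%:E.

(* Mutual independence of G k and of the draws of iteration k; the product rule
   for subfamilies is the case where some of A, B j are the full set. *)
Definition independent_draws : Prop :=
  forall k (A : set T) (B : nat -> set 'I_n), (0 < k)%N -> G k A ->
    Pr (A `&` \bigcap_(j < batch_size k) (xi k j @^-1` B j)) =
    (Pr A * \prod_(j < batch_size k) Pr (xi k j @^-1` B j))%E.

Definition psfw : Prop :=
  [/\ [/\ filtration, adapted, uniform_draws & independent_draws],
      forall t, vertices C d (x 1 t),
      forall t v, vertices C d v -> mu 1 t v = (v == x 1 t)%:R &
      forall k t, (0 < k)%N ->
        psfw_step (batch_size k) (fun j => xi k j t) (x k t) (mu k t)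
          (pv k t) (uv k t) (gam k t) (x k.+1 t) (mu k.+1 t)].

End run.
End problem.

(* Main.v *)
Require Import Defs.
From HB Require Import structures.
From mathcomp Require Import all_boot all_order all_algebra finmap.
From mathcomp Require Import all_classical all_reals all_analysis.
From mathcomp Require Import measurable_realfun ring lra.

Set Implicit Arguments.
Unset Strict Implicit.
Unset Printing Implicit Defensive.

Import Order.TTheory GRing.Theory Num.Theory.
Import numFieldNormedType.Exports.

Local Open Scope classical_set_scope.
Local Open Scope ring_scope.

(* Only the existence of some positive rate is claimed, so all constants may be
   chosen generously. Write h_k = F(x_k) - F^*, G_k for the pairwise gap
   <g_k, u_k - p_k>, and W_k = sum_i |N_i / m_k - 1 / n| for the sampling noise
   of iteration k, where N_i counts the draws equal to i. Everything up to the
   last step is an argument along a fixed outcome.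

   Since a point with slack zeta0 / |V| in the non-active constraints is
   available as an average of the active vertices, strong convexity gives
   h_k <= A (G_k^2 + W_k). A step is good if it decreases the sampled objective
   by at least G_k^2 / (2 L D^2); otherwise it moves the full weight of u_k to
   p_k, decreases the sampled objective by gamma_k G_k / 2, and deactivates u_k.
   Bad steps are controlled without counting configurations: among |V| + 1
   consecutive bad steps some vertex is dropped twice, so it re-enters in
   between as a minimising vertex although it was worse by G_i when dropped.
   Hence the gradient has changed by at least G_i / D, i.e. the weights
   moved meanwhile add up to a multiple of G_i (up to noise), and the total
   decrease is again at least a multiple of G^2. This argument is insensitive to
   the noise and to the reweighting allowed by Caratheodory's theorem. It yields
   (1 + eta) h_{k + |V| + 1} <= h_k + C (W_k + ... + W_{k + |V|}).

   Unrolling bounds h_k by a measurable function of the draws, and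
   E (N_i / m_k - 1 / n)^2 <= 1 / m_k <= (1 - kappa)^(2k + 2) by pairwise
   independence of the draws of one batch. *)

(** * Euclidean geometry and smooth functions *)

Section euclidean_theory.
Context {R : realType} {p : nat}.
Implicit Types (x y z : 'cV[R]_p) (a : R).

Lemma dotC x y : dot x y = dot y x.
Proof. by apply: eq_bigr => i _; rewrite mulrC. Qed.

Lemma dotDl x y z : dot (x + y) z = dot x z + dot y z.
Proof. by rewrite -big_split; apply: eq_bigr => i _; rewrite mxE mulrDl. Qed.

Lemma dotZl a x y : dot (a *: x) y = a * dot x y.
Proof. by rewrite mulr_sumr; apply: eq_bigr => i _; rewrite mxE mulrA. Qed.

Lemma dotNl x y : dot (- x) y = - dot x y.
Proof. by rewrite -scaleN1r dotZl mulN1r. Qed.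

Lemma dotBl x y z : dot (x - y) z = dot x z - dot y z.
Proof. by rewrite dotDl dotNl. Qed.

Lemma dotDr x y z : dot x (y + z) = dot x y + dot x z.
Proof. by rewrite dotC dotDl !(dotC x). Qed.

Lemma dotZr a x y : dot x (a *: y) = a * dot x y.
Proof. by rewrite dotC dotZl dotC. Qed.

Lemma dotNr x y : dot x (- y) = - dot x y.
Proof. by rewrite dotC dotNl dotC. Qed.

Lemma dotBr x y z : dot x (y - z) = dot x y - dot x z.
Proof. by rewrite dotDr dotNr. Qed.

Lemma dot0r x : dot x 0 = 0.
Proof. by rewrite -(scale0r 0) dotZr mul0r. Qed.

Lemma dot_suml I (r : seq I) (P : pred I) (F : I -> 'cV[R]_p) y :
  dot (\sum_(i <- r | P i) F i) y = \sum_(i <- r | P i) dot (F i) y.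
Proof.
elim/big_rec2: _ => [|i a b _ <-]; last by rewrite dotDl.
by rewrite dotC dot0r.
Qed.

Lemma dot_sumr I (r : seq I) (P : pred I) (F : I -> 'cV[R]_p) y :
  dot y (\sum_(i <- r | P i) F i) = \sum_(i <- r | P i) dot y (F i).
Proof. by rewrite dotC dot_suml; apply: eq_bigr => i _; rewrite dotC. Qed.

Lemma dot_ge0 x : 0 <= dot x x.
Proof. by apply: sumr_ge0 => i _; rewrite -expr2 sqr_ge0. Qed.

Lemma enorm_ge0 x : 0 <= enorm x.
Proof. exact: sqrtr_ge0. Qed.

Lemma enorm_sqr x : enorm x ^+ 2 = dot x x.
Proof. by rewrite sqr_sqrtr// dot_ge0. Qed.

Lemma dot_eq0 x : dot x x = 0 -> x = 0.
Proof.
move=> /eqP; rewrite psumr_eq0; last by move=> i _; rewrite -expr2 sqr_ge0.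
move=> /allP x0; apply/colP => i; rewrite mxE.
by have := x0 i (mem_index_enum _); rewrite /= mulf_eq0 orbb => /eqP.
Qed.

Lemma enorm_eq0 x : enorm x = 0 -> x = 0.
Proof. by move=> x0; apply: dot_eq0; rewrite -enorm_sqr x0 expr0n. Qed.

Lemma enorm0 : enorm (0 : 'cV[R]_p) = 0.
Proof. by rewrite /enorm dot0r sqrtr0. Qed.

Lemma enorm_gt0 x : x != 0 -> 0 < enorm x.
Proof.
move=> x0; rewrite lt_def enorm_ge0 andbT.
by apply: contra_neq x0 => /enorm_eq0.
Qed.

Lemma enormZ a x : enorm (a *: x) = `|a| * enorm x.
Proof. by rewrite /enorm dotZl dotZr mulrA -expr2 sqrtrM ?sqr_ge0// sqrtr_sqr. Qed.

Lemma enormN x : enorm (- x) = enorm x.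
Proof. by rewrite -scaleN1r enormZ normrN1 mul1r. Qed.

Lemma enorm_distC x y : enorm (x - y) = enorm (y - x).
Proof. by rewrite -enormN opprB. Qed.

(** Expand the squared length of [|y|^2 x - <x, y> y], which is nonnegative, and cancel the factor
    [|y|^2]. *)
Lemma cauchy_schwarz x y : dot x y <= enorm x * enorm y.
Proof.
have [->|y0] := eqVneq y 0; first by rewrite dot0r enorm0 mulr0.
have ny := enorm_gt0 y0.
apply: le_trans (ler_norm _) _; rewrite -ler_sqr ?nnegrE ?normr_ge0//; last first.
  by rewrite mulr_ge0 ?enorm_ge0.
rewrite real_normK ?num_real// exprMn.
have := dot_ge0 (enorm y ^+ 2 *: x - dot x y *: y).
rewrite dotBl !dotBr !dotZl !dotZr -!enorm_sqr (dotC y x).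
have -> : enorm y ^+ 2 * (enorm y ^+ 2 * enorm x ^+ 2) -
  enorm y ^+ 2 * (dot x y * dot x y) - (dot x y * (enorm y ^+ 2 * dot x y) -
  dot x y * (dot x y * enorm y ^+ 2)) =
  enorm y ^+ 2 * (enorm x ^+ 2 * enorm y ^+ 2 - dot x y ^+ 2) by ring.
by rewrite pmulr_rge0 ?exprn_gt0// subr_ge0.
Qed.

Lemma dot_geN x y : - (enorm x * enorm y) <= dot x y.
Proof. by rewrite lerNl -dotNl (le_trans (cauchy_schwarz _ _))// enormN. Qed.

Lemma enormD x y : enorm (x + y) <= enorm x + enorm y.
Proof.
rewrite -ler_sqr ?nnegrE ?addr_ge0 ?enorm_ge0//.
rewrite sqrrD !enorm_sqr dotDl !dotDr (dotC y x).
by have := cauchy_schwarz x y; lra.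
Qed.

Lemma enorm_sum I (r : seq I) (P : pred I) (F : I -> 'cV[R]_p) :
  enorm (\sum_(i <- r | P i) F i) <= \sum_(i <- r | P i) enorm (F i).
Proof.
elim/big_rec2: _ => [|i a b _ h]; first by rewrite enorm0.
by rewrite (le_trans (enormD _ _))// lerD2l.
Qed.

(** Transfers boundedness from the sup norm, in which compactness is available, to Euclidean length;
    the factor [p] in place of its square root is enough. *)
Lemma enorm_le_mx_norm x : enorm x <= p%:R * `|x|.
Proof.
have coord_le i : `|x i ord0| <= `|x|.
  rewrite {2}/Num.norm /= mx_normrE.
  exact: (le_bigmax _ (fun ij => `|x ij.1 ij.2|) (i, ord0)).
rewrite -ler_sqr ?nnegrE ?enorm_ge0 ?mulr_ge0//.
rewrite enorm_sqr exprMn.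
apply: (@le_trans _ _ (\sum_(i < p) `|x| ^+ 2)).
  apply: ler_sum => i _; rewrite -expr2 -[_ ^+ 2]real_normK ?num_real//.
  by rewrite lerXn2r ?nnegrE.
rewrite sumr_const card_ord -[leLHS]mulr_natl ler_wpM2r ?sqr_ge0//.
by rewrite -natrX ler_nat; case: (p) => // k; rewrite expnS leq_pmulr ?expn_gt0.
Qed.

End euclidean_theory.

(** * Gradients along lines, the quadratic bound for smooth functions, first-order strong
    convexity *)

Section differential.
Context {R : realType} {p : nat}.
Implicit Types (f : 'cV[R]_p -> R) (x v : 'cV[R]_p) (t L s : R).

(** [grad] only collects partial derivatives; differentiability makes the directional derivative
    linear in the direction, hence determined by them. *)
Lemma dot_grad f x v : differentiable f x -> dot (grad f x) v = 'D_v f x.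
Proof.
move=> df; rewrite deriveE//.
have {2}-> : v = \sum_(i < p) v i ord0 *: delta_mx i ord0.
  by rewrite {1}(matrix_sum_delta v); apply: eq_bigr => i _; rewrite big_ord1.
rewrite linear_sum; apply: eq_bigr => i _.
by rewrite mxE deriveE// linearZ /= mulrC.
Qed.

Lemma is_derive_line f x v t : differentiable f (x + t *: v) ->
  is_derive t 1 (fun s => f (x + s *: v)) (dot (grad f (x + t *: v)) v).
Proof.
move=> df; rewrite dot_grad//.
have e : (fun h : R => h^-1 *: (f (x + (h *: 1 + t) *: v) - f (x + t *: v))) =
  (fun h : R => h^-1 *: (f (h *: v + (x + t *: v)) - f (x + t *: v))).
  by apply/funext => h; rewrite /= [h *: 1]mulr1 scalerDl addrCA.
have dv : derivable f (x + t *: v) v by exact: diff_derivable.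
by split; rewrite /derivable /derive /= e.
Qed.

Lemma lipschitz_grad_monotone f x v L t : lipschitz_grad L f -> 0 <= t ->
  dot (grad f (x + t *: v)) v <= dot (grad f x) v + L * t * enorm v ^+ 2.
Proof.
move=> lf t0; rewrite [leRHS]addrC -lerBlDr -dotBl.
apply: le_trans (cauchy_schwarz _ _) _.
rewrite expr2 mulrA ler_wpM2r ?enorm_ge0//.
apply: le_trans (lf _ _) _.
by rewrite [x + _]addrC addrK enormZ ger0_norm// mulrA.
Qed.

Lemma lipschitz_grad_monotone_ge f x v L t : lipschitz_grad L f -> 0 <= t ->
  dot (grad f x) v - L * t * enorm v ^+ 2 <= dot (grad f (x + t *: v)) v.
Proof.
move=> lf t0; rewrite lerBlDr -lerBlDl -dotBl.
apply: le_trans (cauchy_schwarz _ _) _.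
rewrite expr2 mulrA ler_wpM2r ?enorm_ge0//.
apply: le_trans (lf _ _) _.
by rewrite opprD addNKr enormN enormZ ger0_norm// mulrA.
Qed.

Lemma descent f L x v : (forall y, differentiable f y) -> lipschitz_grad L f ->
  `|f (x + v) - f x - dot (grad f x) v| <= L / 2 * enorm v ^+ 2.
Proof.
move=> df lf.
(* The curvature [c] is left free: the mean value theorem on [0, 1] with [c = L / 2 |v|^2] gives the
   upper bound, and with the opposite value the lower one. *)
pose h (c : R) (t : R) := f (x + t *: v) - (t * dot (grad f x) v + t ^+ 2 * c).
have dh (c t : R) : is_derive t 1 (h c)
    (dot (grad f (x + t *: v)) v - (dot (grad f x) v + 2 * t * c)).
  have := is_derive_line (df (x + t *: v)) => dl.
  have dg : is_derive t 1 (fun s => s * dot (grad f x) v + s ^+ 2 * c)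
      (dot (grad f x) v + 2 * t * c).
    have -> : (fun s => s * dot (grad f x) v + s ^+ 2 * c) =
        (dot (grad f x) v *: (@id R)) + (c *: (@id R) ^+ 2).
      by apply/funext => s; rewrite fctE /= mulrC [_ ^+ 2 * _]mulrC.
    have di := is_derive_id t (1 : R).
    apply: (is_derive_eq (is_deriveD (is_deriveZ _ di)
      (is_deriveZ _ (is_deriveX 2 di)))).
    by rewrite /GRing.scale /=; ring.
  exact: is_deriveB.
have hE c : exists2 t, t \in `[0, 1]%R & f (x + v) - f x - dot (grad f x) v - c =
    dot (grad f (x + t *: v)) v - (dot (grad f x) v + 2 * t * c).
  have ch : {within `[0, 1], continuous (h c)}.
    by apply: derivable_within_continuous => t _; have [] := dh c t.
  have [t t01] := @MVT_segment R (h c) _ 0 1 ler01 (fun t _ => dh c t) ch.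
  rewrite /h subr0 mulr1 scale1r scale0r addr0 mul1r expr1n expr0n.
  rewrite !mul0r mul1r addr0 subr0.
  by move=> e; exists t => //; rewrite -e; ring.
rewrite ler_norml; apply/andP; split.
  have [t] := hE (- (L / 2 * enorm v ^+ 2)); rewrite in_itv /= => /andP[t0 _] e.
  have := lipschitz_grad_monotone_ge x v lf t0; lra.
have [t] := hE (L / 2 * enorm v ^+ 2); rewrite in_itv /= => /andP[t0 _] e.
have := lipschitz_grad_monotone x v lf t0; lra.
Qed.

(* Comparing strong convexity at a point close to x with [descent] yields the
   first-order inequality without any limit, at the price of halving the
   constant. *)
Lemma strongly_convex_grad f s L x y : (forall z, differentiable f z) ->
  lipschitz_grad L f -> strongly_convex s f -> 0 < s -> 0 <= L ->
  f x + dot (grad f x) (y - x) + s / 4 * enorm (y - x) ^+ 2 <= f y.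
Proof.
move=> df lf sf s0 L0.
(* With [a (s + L) = s / 2], the strong convexity gain [s / 2 a (1 - a)] exceeds the smoothness
   error [L / 2 a^2] by exactly [a s / 4]. *)
pose a := s / (2 * (s + L)).
have sL : 0 < s + L by lra.
have a0 : 0 < a by rewrite divr_gt0// mulr_gt0.
have aE : a * (s + L) = s / 2 by rewrite /a; field; lra.
have a1 : a <= 1 by nra.
have := sf y x a; rewrite a1 ltW// => /(_ isT).
have -> : a *: y + (1 - a) *: x = x + a *: (y - x).
  by rewrite scalerBl scale1r scalerBr addrC addrAC addrA.
have := descent x (a *: (y - x)) df lf.
rewrite ler_norml => /andP[+ _]; rewrite dotZr enormZ (ger0_norm (ltW a0)) exprMn.
set N := enorm _ ^+ 2; set g := dot _ _ => h1 h2.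
have N0 : 0 <= N by exact: sqr_ge0.
have h3 : a * (f x + g + s / 4 * N) <= a * f y.
  have e : a * (s + L) * N = s / 2 * N by rewrite aE.
  nra.
by rewrite ler_pM2l in h3.
Qed.

End differential.

(** * Polyhedra *)

(** The default value 1 of the minimum keeps the bound positive even when no index satisfies [P]. *)
Lemma finite_pos_lower_bound (R : realType) (I : finType) (P : pred I)
    (F : I -> R) : (forall i, P i -> 0 < F i) ->
  exists2 e, 0 < e & forall i, P i -> e <= F i.
Proof.
move=> F0; exists (\big[Num.min/1]_(i | P i) F i).
  exact: lt_bigmin.
by move=> i Pi; exact: bigmin_le_cond.
Qed.

Lemma finite_pos_upper_bound (R : realType) (I : finType) (P : pred I)
    (F : I -> R) : exists2 e, 0 < e & forall i, P i -> F i <= e.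
Proof.
exists (\big[Num.max/1]_(i | P i) F i).
  by rewrite (lt_le_trans ltr01)// bigmax_ge_id.
by move=> i Pi; exact: le_bigmax_cond.
Qed.

Section polyhedron_theory.
Context {R : realType} {m p : nat}.
Variables (C : 'M[R]_(m, p)) (d : 'cV[R]_m).
Implicit Types (x y z v g : 'cV[R]_p) (i : 'I_m).

Lemma mulmx_dot i x : (C *m x) i ord0 = dot (row i C)^T x.
Proof. by rewrite mxE; apply: eq_bigr => j _; rewrite !mxE. Qed.

(** Along [z = w - v] the tight constraints have slope zero and the others have slack, so [v + e z]
    and [v - e z] are both feasible for small [e]. Since [v] is their midpoint, extremality forces
    [z = 0]. *)
Lemma vertices_active_inj v w : vertices C d v -> vertices C d w ->
  (forall i, (C *m v) i ord0 = d i ord0 <-> (C *m w) i ord0 = d i ord0) ->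
  v = w.
Proof.
move=> [Pv ev] [Pw ew] act.
pose z := w - v; pose c i := dot (row i C)^T z.
have [e e0 he] : exists2 e, 0 < e & forall i, (C *m v) i ord0 < d i ord0 ->
    e <= (d i ord0 - (C *m v) i ord0) / (1 + `|c i|).
  apply: finite_pos_lower_bound => i iv.
  by rewrite divr_gt0// ?subr_gt0// ltr_wpDr.
have inP s : `|s| = e -> polyhedron C d (v + s *: z).
  move=> se i; rewrite mulmx_dot dotDr dotZr -/(c i) -mulmx_dot.
  have [iv|iv] := eqVneq ((C *m v) i ord0) (d i ord0).
    have iw := (act i).1 iv.
    by rewrite /c dotBr -!mulmx_dot iv iw subrr mulr0 addr0.
  have {}iv : (C *m v) i ord0 < d i ord0 by rewrite lt_neqAle iv Pv.
  rewrite -lerBrDl; apply: le_trans (ler_norm _) _; rewrite normrM se.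
  have := he _ iv; rewrite ler_pdivlMr ?ltr_wpDr// => h.
  by apply: le_trans h; rewrite ler_wpM2l ?(ltW e0)// lerDr.
have Pe : polyhedron C d (v + e *: z) by apply: inP; rewrite gtr0_norm.
have Pn : polyhedron C d (v + (- e) *: z) by apply: inP; rewrite normrN gtr0_norm.
have h2 : 0 < (2^-1 : R) < 1 by rewrite invr_gt0 invf_lt1 ?ltr0n ?ltr1n.
have /addrI : v + e *: z = v + (- e) *: z.
  by apply: ev Pe Pn h2 _; apply/colP => j; rewrite !mxE; field.
move=> /eqP; rewrite -subr_eq0 -scalerBl opprK scaler_eq0.
rewrite gt_eqF ?addr_gt0//= => h; by apply/esym/eqP; rewrite -subr_eq0.
Qed.

(** A vertex is determined by its set of tight constraints, and there are finitely many such sets.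
    Non-vertices are sent to [None], so injectivity is only needed on the vertices. *)
Lemma finite_vertices : finite_set (vertices C d).
Proof.
pose F v : option {set 'I_m} := if v \in vertices C d then
  Some [set i | (C *m v) i ord0 == d i ord0]%SET else None.
have -> : vertices C d = F @^-1` [set o | o != None].
  apply/seteqP; split => v /=; rewrite /F.
    by move=> Vv; rewrite mem_set.
  by case: ifPn => // /set_mem.
apply: finite_preimage; last exact: finite_finset.
move=> v w; rewrite !inE /= /F.
case: ifPn => // /set_mem Vv _; case: ifPn => // /set_mem Vw _ [] /setP act.
apply: vertices_active_inj => // i.
by have := act i; rewrite !inE => e; split => /eqP h; apply/eqP; rewrite ?e// -e.
Qed.

Local Notation VS := (fset_set (vertices C d)).

Lemma mem_vertices v : v \in VS <-> vertices C d v.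
Proof.
by rewrite (in_fset_set finite_vertices); split => [/set_mem|/mem_set].
Qed.

Lemma sum_vertices (M : nmodType) (F : 'cV[R]_p -> M) :
  \sum_(v \in vertices C d) F v = \sum_(v <- VS) F v.
Proof. by rewrite fsbig_finite//; exact: finite_vertices. Qed.

Definition represents (mu : 'cV[R]_p -> R) x :=
  [/\ forall v, vertices C d v -> 0 <= mu v,
      \sum_(v \in vertices C d) mu v = 1 &
      \sum_(v \in vertices C d) mu v *: v = x].

Lemma dot_represents mu x g : represents mu x ->
  dot g x = \sum_(v <- VS) mu v * dot g v.
Proof.
by case=> _ _ <-; rewrite sum_vertices dot_sumr; apply: eq_bigr => v _; rewrite dotZr.
Qed.

Lemma polyhedron_represents mu x : represents mu x -> polyhedron C d x.
Proof.
move=> rx i; rewrite mulmx_dot (dot_represents _ rx).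
have [mu0 mu1 _] := rx.
rewrite -[leRHS]mul1r -mu1 sum_vertices mulr_suml !big_seq.
apply: ler_sum => v /mem_vertices Vv.
by rewrite ler_wpM2l ?mu0// -mulmx_dot; case: Vv.
Qed.

End polyhedron_theory.

(** * Positivity of the geometric constants, and the pairwise gap inequality *)

Section compact_polyhedron.
Context {R : realType} {m p : nat}.
Variables (C : 'M[R]_(m, p)) (d : 'cV[R]_m).
Hypothesis cptP : compact (polyhedron C d).
Hypothesis nontrivP : exists y z,
  [/\ polyhedron C d y, polyhedron C d z & y != z].
Hypothesis vertex_ex : exists v, vertices C d v.
Implicit Types (x y z v g : 'cV[R]_p) (i : 'I_m).

Local Notation P := (polyhedron C d).
Local Notation D := (diameter C d).
Local Notation VS := (fset_set (vertices C d)).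

Lemma polyhedron_enorm_bounded : exists B, forall x, P x -> enorm x <= B.
Proof.
have [M [_ hM]] := compact_bounded cptP.
exists (p%:R * (M + 1)) => x Px; apply: le_trans (enorm_le_mx_norm x) _.
by rewrite ler_wpM2l//; apply: hM => //; rewrite ltrDl.
Qed.

Lemma le_diameter x y : P x -> P y -> enorm (x - y) <= D.
Proof.
move=> Px Py; apply: ub_le_sup; last by exists x, y.
have [B hB] := polyhedron_enorm_bounded.
exists (B + B) => _ [z [w [Pz Pw ->]]].
by rewrite (le_trans (enormD _ _))// enormN lerD// hB.
Qed.

Lemma diameter_gt0 : 0 < D.
Proof.
have [y [z [Py Pz yz]]] := nontrivP.
by apply: lt_le_trans (le_diameter Py Pz); rewrite enorm_gt0// subr_eq0.
Qed.

Lemma polyhedron_no_ray x z : (forall t, 0 <= t -> P (x + t *: z)) -> z = 0.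
Proof.
move=> ray; apply/eqP/negPn/negP => z0.
have nz := enorm_gt0 z0.
have D0 := diameter_gt0.
have t0 : 0 <= (D + 1) / enorm z by rewrite divr_ge0// ?enorm_ge0// addr_ge0// ltW.
have Px : P x by have := ray 0 (lexx _); rewrite scale0r addr0.
have := le_diameter (ray _ t0) Px.
rewrite [x + _]addrC addrK enormZ ger0_norm// divfK ?gt_eqF//.
by rewrite leNgt ltrDl ltr01.
Qed.

(** Keeps [zeta0] and [phi0] from being degenerate. If every constraint slack at a vertex [v0] had a
    zero row, the whole ray from [v0] through another point [y] would be feasible, since constraints
    tight at [v0] do not increase towards [y]; this contradicts boundedness. *)
Lemma exists_slack_constraint : exists v i,
  [/\ vertices C d v, (C *m v) i ord0 < d i ord0 & (row i C)^T != 0].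
Proof.
have [v0 Vv0] := vertex_ex; have Pv0 := Vv0.1.
have [y Py yv] : exists2 y, P y & y != v0.
  have [y [z [Py Pz yz]]] := nontrivP.
  have [yv|yv] := eqVneq y v0; last by exists y.
  by exists z => //; rewrite -yv eq_sym.
apply: contrapT => no.
suff /eqP : y - v0 = 0 by rewrite subr_eq0 (negPf yv).
apply: (@polyhedron_no_ray v0) => t t0 i.
rewrite mulmx_dot dotDr dotZr dotBr -!mulmx_dot.
have [iv|iv] := eqVneq ((C *m v0) i ord0) (d i ord0).
  by have := Py i; rewrite iv; nra.
have {}iv : (C *m v0) i ord0 < d i ord0 by rewrite lt_neqAle iv Pv0.
have [r0|r0] := eqVneq (row i C)^T 0; last by case: no; exists v0, i.
rewrite !mulmx_dot r0 ![dot 0 _]dotC !dot0r subrr mulr0 addr0.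
by rewrite -(dot0r v0) dotC -r0 -mulmx_dot Pv0.
Qed.

Lemma zeta0_ge e : 
  (forall v i, vertices C d v -> (C *m v) i ord0 < d i ord0 ->
     e <= d i ord0 - (C *m v) i ord0) -> e <= zeta0 C d.
Proof.
move=> he; have [v [i [Vv iv _]]] := exists_slack_constraint.
apply: lb_le_inf; first by exists (d i ord0 - (C *m v) i ord0), v, i.
by move=> _ [w [j [Vw jw ->]]]; exact: he.
Qed.

Lemma zeta0_le v i : vertices C d v -> (C *m v) i ord0 < d i ord0 ->
  zeta0 C d <= d i ord0 - (C *m v) i ord0.
Proof.
move=> Vv iv; apply: ge_inf; last by exists v, i.
by exists 0 => _ [w [j [_ jw ->]]]; rewrite subr_ge0 ltW.
Qed.

Lemma zeta0_gt0 : 0 < zeta0 C d.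
Proof.
pose F (vi : VS * 'I_m) := d vi.2 ord0 - (C *m val vi.1) vi.2 ord0.
have [e e0 he] : exists2 e, 0 < e & forall vi, 0 < F vi -> e <= F vi.
  exact: finite_pos_lower_bound.
apply: lt_le_trans e0 _; apply: zeta0_ge => v i /mem_vertices Vv iv.
by apply: (he ([` Vv]%fset, i)); rewrite /F subr_gt0.
Qed.

Lemma phi0_ge v i : vertices C d v -> (C *m v) i ord0 < d i ord0 ->
  enorm (row i C)^T <= phi0 C d.
Proof.
move=> Vv iv; apply: ub_le_sup; last first.
  by exists i => //= act; move: iv; rewrite act// ltxx.
have [e _ he] := finite_pos_upper_bound xpredT (fun i => enorm (row i C)^T).
by exists e => _ [j _ <-]; exact: he.
Qed.

Lemma phi0_gt0 : 0 < phi0 C d.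
Proof.
have [v [i [Vv iv r0]]] := exists_slack_constraint.
by apply: lt_le_trans (phi0_ge Vv iv); exact: enorm_gt0.
Qed.

Lemma Omega_gt0 : 0 < Omega C d.
Proof. by rewrite divr_gt0 ?zeta0_gt0 ?phi0_gt0. Qed.

Lemma nb_vertices_gt0 : (0 < nb_vertices C d)%N.
Proof.
have [v /mem_vertices Vv] := vertex_ex.
by rewrite cardfs_gt0; apply/fset0Pn; exists v.
Qed.

(* The uniform average [u] of the active vertices has slack at least
   [zeta0 / |V|] in every constraint that is not tight on all of them, hence
   [u + t (y - x)] stays in the polyhedron for [t = Omega / (|V| |y - x|)]. *)
Lemma pairwise_gap_ge mu x y g (a b : R) :
  represents C d mu x -> P y ->
  (forall z, P z -> a <= dot g z) ->
  (forall v, active C d mu v -> dot g v <= b) ->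
  Omega C d / (nb_vertices C d)%:R * dot g (x - y) <= (b - a) * enorm (x - y).
Proof.
move=> rx Py ha hb; have [mu0 mu1 _] := rx.
have [->|xy] := eqVneq x y; first by rewrite subrr dot0r enorm0 !mulr0.
have nxy : 0 < enorm (x - y) by rewrite enorm_gt0// subr_eq0.
pose w v : R := (0 < mu v)%R%:R.
have w0 v : 0 <= w v by [].
pose N := \sum_(v <- VS) w v.
(* Each weight is at most 1, so [mu v <= w v], and the weights [mu] sum to 1. *)
have N1 : 1 <= N.
  rewrite -mu1 sum_vertices /N !big_seq ler_sum// => v Vv.
  rewrite /w; case: (ltP 0 (mu v)) => // _.
  rewrite -mu1 sum_vertices (big_rem v)//= lerDl big_seq sumr_ge0// => v' vr.
  by apply/mu0/mem_vertices; exact: mem_rem vr.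
have NV : N <= (nb_vertices C d)%:R.
  rewrite /N /nb_vertices -sum1_size natr_sum ler_sum// => v _.
  by rewrite ler_nat leq_b1.
pose u := \sum_(v <- VS) (w v / N) *: v.
have dotu h : N * dot h u = \sum_(v <- VS) w v * dot h v.
  rewrite dot_sumr mulr_sumr; apply: eq_bigr => v _; rewrite dotZr.
  by field; lra.
have V0 : 0 < (nb_vertices C d)%:R :> R by rewrite ltr0n nb_vertices_gt0.
have z0 := zeta0_gt0; have f0 := phi0_gt0.
pose t := Omega C d / ((nb_vertices C d)%:R * enorm (x - y)).
have t0 : 0 < t by rewrite divr_gt0 ?Omega_gt0// mulr_gt0.
have tE : t * (phi0 C d * enorm (x - y)) = zeta0 C d / (nb_vertices C d)%:R.
  by rewrite /t /Omega; field; rewrite !gt_eqF.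
have ub : dot g u <= b.
  have : N * dot g u <= N * b.
    rewrite dotu mulr_suml !big_seq ler_sum// => v /mem_vertices Vv.
    rewrite /w; case: (ltP 0 (mu v)) => mv; last by rewrite !mul0r.
    by rewrite !mul1r hb.
  by rewrite ler_pM2l//; lra.
have Pu : P (u + t *: (y - x)).
  move=> i; rewrite mulmx_dot; set c := (row i C)^T.
  have cv v : dot c v = (C *m v) i ord0 by rewrite mulmx_dot.
  have uE : N * (d i ord0 - dot c u) =
      \sum_(v <- VS) w v * (d i ord0 - (C *m v) i ord0).
    rewrite mulrBr dotu mulr_suml -sumrB; apply: eq_bigr => v _.
    by rewrite mulrBr cv.
  have pos v : v \in VS -> 0 <= w v * (d i ord0 - (C *m v) i ord0).
    by move=> /mem_vertices[Pv _]; rewrite mulr_ge0// subr_ge0.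
  rewrite dotDr dotZr.
  (* If the constraint is slack at some active vertex, its slack at [u] covers the displacement by
     the choice of [t]. If it is tight at all active vertices, it is tight at both [x] and [u] and
     does not increase in the direction [y - x]. *)
  have [[v0 [av0 iv0]]|tight] :=
      pselect (exists v, active C d mu v /\ (C *m v) i ord0 < d i ord0).
    have h1 : zeta0 C d <= N * (d i ord0 - dot c u).
      apply: (le_trans (zeta0_le av0.1 iv0)); rewrite uE.
      have Vv0 : v0 \in VS by apply/mem_vertices; case: av0.
      rewrite (big_rem v0)//= /w av0.2 mul1r lerDl big_seq sumr_ge0// => v vr.
      by apply: pos; exact: mem_rem vr.
    have h2 : dot c (y - x) <= phi0 C d * enorm (x - y).
      apply: le_trans (cauchy_schwarz _ _) _; rewrite enorm_distC.
      by rewrite ler_wpM2r ?enorm_ge0// (phi0_ge av0.1 iv0).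
    have h3 : t * dot c (y - x) <= zeta0 C d / (nb_vertices C d)%:R.
      by rewrite -tE ler_pM2l.
    have h4 : zeta0 C d / (nb_vertices C d)%:R <= zeta0 C d / N.
      by rewrite ler_pM2l// lef_pV2// posrE; lra.
    have h5 : zeta0 C d / N <= d i ord0 - dot c u.
      by rewrite ler_pdivrMr ?[_ * N]mulrC//; lra.
    lra.
  have tg v : v \in VS -> 0 < mu v -> (C *m v) i ord0 = d i ord0.
    move=> /mem_vertices Vv mv; apply/eqP; rewrite eq_le Vv.1/= leNgt.
    by apply/negP => iv; apply: tight; exists v.
  have hx : dot c x = d i ord0.
    rewrite (dot_represents _ rx) -[RHS]mul1r -mu1 sum_vertices mulr_suml.
    rewrite !big_seq; apply: eq_bigr => v Vv; rewrite cv.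
    have := mu0 v; rewrite -mem_vertices => /(_ Vv).
    by rewrite le_eqVlt => /predU1P[<-|mv]; rewrite ?mul0r// tg.
  have hu : dot c u = d i ord0.
    have : N * (d i ord0 - dot c u) = 0.
      rewrite uE big_seq big1// => v Vv; rewrite /w.
      by case: (ltP 0 (mu v)) => mv; rewrite ?mul0r// tg// subrr mulr0.
    have Nn0 : N != 0 by rewrite gt_eqF// (lt_le_trans ltr01).
    by move=> /eqP; rewrite mulf_eq0 (negPf Nn0)/= subr_eq0 => /eqP.
  have := Py i; rewrite mulmx_dot -/c dotBr hx hu; nra.
(* The lower bound [a] at the new point and the upper bound [b] at [u] leave
   [t <g, x - y> <= b - a]. *)
have h := ha _ Pu; rewrite dotDr dotZr -(opprB x y) dotNr in h.
have : t * dot g (x - y) <= b - a by lra.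
rewrite -(ler_pM2r nxy); apply: le_trans; rewrite le_eqVlt; apply/orP; left.
by apply/eqP; rewrite /t; field; rewrite !gt_eqF.
Qed.

End compact_polyhedron.

(** * Recurrences *)

Section window.
Context {R : realType} {T : eqType}.
(** Abstract record of a run: [u k] loses weight and [q k] gains it, [act k] is the active set, [h]
    the optimality gap, [Delta] the decrease of the sampled objective, [G] the pairwise gap, [W] the
    noise and [gam] the step size. *)
Variables (V : seq T) (u q : nat -> T) (act : nat -> T -> Prop).
Variables (h Delta G W gam : nat -> R) (A B D L : R).
Hypotheses (A_gt0 : 0 < A) (B_ge0 : 0 <= B) (D_gt0 : 0 < D) (L_gt0 : 0 < L).
Hypothesis uV : forall k, u k \in V.
Hypothesis act_u : forall k, act k (u k).
Hypothesis act_step : forall k v, act k.+1 v -> act k v \/ v = q k.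
Hypothesis W_ge0 : forall k, 0 <= W k.
Hypothesis gam_ge0 : forall k, 0 <= gam k.
Hypothesis G_bounds : forall k, 0 <= G k <= B * D.
Hypothesis h_step : forall k, h k.+1 <= h k - Delta k + 2 * B * W k.
Hypothesis h_gap : forall k, h k <= A * (G k ^+ 2 + W k).
Hypothesis good_or_bad : forall k, G k ^+ 2 / (2 * L * D ^+ 2) <= Delta k \/
  [/\ gam k * G k / 2 <= Delta k, ~ act k.+1 (u k) & u k != q k].
Hypothesis reentry : forall i l, (i < l)%N -> u i = q l ->
  G i <= D * (L * D * (\sum_(i <= j < l) gam j) + B * (W i + W l)).

Let Delta_ge0 k : 0 <= Delta k.
Proof.
have /andP[G0 _] := G_bounds k.
case: (good_or_bad k) => [|[]] + *; apply: le_trans.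
  by rewrite divr_ge0 ?sqr_ge0 ?mulr_ge0 ?ltW.
by rewrite divr_ge0 ?mulr_ge0.
Qed.

Let ler_sum_subrange (F : nat -> R) k i l n : (forall j, 0 <= F j) ->
  (k <= i)%N -> (i <= l)%N -> (l <= n)%N ->
  \sum_(i <= j < l) F j <= \sum_(k <= j < n) F j.
Proof.
move=> F0 ki il ln.
rewrite (big_cat_nat ki (leq_trans il ln))/= (big_cat_nat il ln)/=.
by rewrite addrCA lerDl addr_ge0 ?sumr_ge0.
Qed.

Lemma h_telescope k n : h (k + n) <= h k -
  \sum_(k <= j < k + n) Delta j + 2 * B * \sum_(k <= j < k + n) W j.
Proof.
elim: n => [|n IH]; first by rewrite addn0 !big_geq// mulr0 subr0 addr0.
rewrite addnS !big_nat_recr ?leq_addr//=.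
by have := h_step (k + n); lra.
Qed.

(** Going back from [l], either [v] has just entered or it was active one step earlier; the latter
    cannot continue down to [i.+1]. *)
Let act_entry i l v : (i < l)%N -> ~ act i.+1 v -> act l v ->
  exists2 j, (i < j < l)%N & v = q j.
Proof.
elim: l => // l IH; rewrite ltnS leq_eqVlt => /predU1P[->//|il] nact.
move=> /act_step[al|->]; last by exists l; rewrite ?il ?ltnS ?leqnn.
have [j /andP[ij jl] ->] := IH il nact al.
by exists j; rewrite // ij ltnS ltnW.
Qed.

Lemma window_decrease k : exists2 j, (k <= j < k + (size V).+1)%N &
  G j ^+ 2 / (2 * L * D ^+ 2) -
    B ^+ 2 / (2 * L) * (\sum_(k <= i < k + (size V).+1) W i)
    <= \sum_(k <= i < k + (size V).+1) Delta i.
Proof.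
set M := (size V).+1; set S := \sum_(k <= j < k + M) W j.
have S0 : 0 <= S by rewrite sumr_ge0.
have BS0 : 0 <= B ^+ 2 / (2 * L) * S.
  by rewrite mulr_ge0// divr_ge0 ?sqr_ge0 ?mulr_ge0 ?ltW.
have [[j kj good]|allbad] := pselect (exists2 j, (k <= j < k + M)%N &
    G j ^+ 2 / (2 * L * D ^+ 2) <= Delta j).
  exists j => //; rewrite lerBlDr (le_trans good)// ler_wpDr//.
  have /andP[kj1 kj2] := kj.
  by have := ler_sum_subrange Delta_ge0 kj1 (leqnSn j) kj2; rewrite big_nat1.
have bad j : (k <= j < k + M)%N ->
    [/\ gam j * G j / 2 <= Delta j, ~ act j.+1 (u j) & u j != q j].
  by move=> kj; case: (good_or_bad j) => // good; case: allbad; exists j.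
(* The smallest gap of the window is used, so that each bad step decreases by at least
   [gam j * G j0 / 2]. *)
have [j0 kj0 minG] : exists2 j, (k <= j < k + M)%N &
    forall i, (k <= i < k + M)%N -> G j <= G i.
  have [j _ hj] := @arg_minP _ R 'I_M ord0 xpredT (fun j => G (k + j)%N) isT.
  exists (k + j)%N; first by rewrite leq_addr ltn_add2l ltn_ord.
  move=> i /andP[ki iM].
  have ikM : (i - k < M)%N by rewrite ltn_subLR.
  by have := hj (Ordinal ikM) isT; rewrite /= subnKC.
exists j0 => //.
(* Pigeonhole: the window has one more step than [V] has elements. *)
have [i [l [ki il lM uil]]] : exists i l,
    [/\ (k <= i)%N, (i < l)%N, (l < k + M)%N & u i = u l].
  pose s := [seq u j | j <- iota k M].
  have : ~~ uniq s.
    apply/negP => /uniq_leq_size us.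
    have : (size s <= size V)%N by apply: us => _ /mapP[j _ ->].
    by rewrite size_map size_iota ltnn.
  move=> /(uniqPn (u 0%N))[i [l [il ls]]].
  rewrite size_map size_iota in ls.
  rewrite !(nth_map 0%N) ?size_iota ?(ltn_trans il)// !nth_iota ?(ltn_trans il)// => uil.
  by exists (k + i)%N, (k + l)%N; rewrite leq_addr !ltn_add2l il ls.
have iM : (k <= i < k + M)%N by rewrite ki (ltn_trans il).
have [_ nact _] := bad i iM.
have [a /andP[ia al] uq] : exists2 j, (i < j < l)%N & u i = q j.
  by apply: act_entry nact _ => //; rewrite uil.
have aM : (a < k + M)%N := ltn_trans al lM.
set Gm := G j0 in minG *.
have /andP[Gm0 GmB] : 0 <= Gm <= B * D by exact: G_bounds.
have GmG := minG i iM.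
have hG := reentry ia uq.
have hW : W i + W a <= S.
  rewrite /S (big_cat_nat ki (ltnW (ltn_trans ia aM)))/=.
  rewrite (big_ltn (ltn_trans ia aM)) (big_cat_nat ia (ltnW aM))/=.
  rewrite (big_ltn aM).
  have s1 := @sumr_ge0 R _ (index_iota k i) xpredT W (fun j _ => W_ge0 j).
  have s2 := @sumr_ge0 R _ (index_iota i.+1 a) xpredT W (fun j _ => W_ge0 j).
  have s3 := @sumr_ge0 R _ (index_iota a.+1 (k + M)) xpredT W (fun j _ => W_ge0 j).
  lra.
set s := \sum_(i <= j < a) gam j in hG.
have hD : Gm / 2 * s <= \sum_(k <= j < k + M) Delta j.
  apply: le_trans (ler_sum_subrange Delta_ge0 ki (ltnW ia) (ltnW aM)).
  rewrite mulr_sumr !big_nat; apply: ler_sum => j /andP[ij ja].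
  have jM : (k <= j < k + M)%N by rewrite (leq_trans ki ij) (ltn_trans ja aM).
  have [+ _ _] := bad j jM; apply: le_trans.
  rewrite mulrAC ler_wpM2r// mulrC ler_wpM2l//; exact: minG.
have hs : Gm - D * B * S <= L * D ^+ 2 * s.
  have DB : D * B * (W i + W a) <= D * B * S.
    by rewrite ler_wpM2l// mulr_ge0// ltW.
  lra.
apply: le_trans hD.
have LD : 0 < 2 * L * D ^+ 2 by rewrite mulr_gt0 ?exprn_gt0// mulr_gt0.
rewrite -(ler_pM2r LD).
have -> : (Gm ^+ 2 / (2 * L * D ^+ 2) - B ^+ 2 / (2 * L) * S) * (2 * L * D ^+ 2) =
   Gm ^+ 2 - B * D * (B * D * S) by field; rewrite !gt_eqF.
have h1 : Gm * (Gm - D * B * S) <= Gm * (L * D ^+ 2 * s) by rewrite ler_wpM2l.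
(* The a priori bound on the gap removes the factor [Gm] from the noise term, which thus stays
   linear in the noise. *)
have h2 : Gm * (B * D * S) <= B * D * (B * D * S).
  by rewrite ler_wpM2r// !mulr_ge0// ltW.
lra.
Qed.

Let eta := (2 * A * L * D ^+ 2)^-1.

(** The gap in [window_decrease] occurs at some [j] inside the window. Up to noise, [h] at the end
    of the window is at most [h j], which [h_gap] bounds by [G j ^+ 2]; hence the window decreases
    [h] by at least [eta] times its final value, and the factor stands on the left. *)
Lemma window_contraction k : (1 + eta) * h (k + (size V).+1) <=
  h k + (2 * B + 2 * B * eta + (2 * L * D ^+ 2)^-1 + B ^+ 2 / (2 * L)) *
        \sum_(k <= j < k + (size V).+1) W j.
Proof.
set M := (size V).+1; set S := \sum_(k <= j < k + M) W j.
have [j /andP[kj jM] hdec] := window_decrease k.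
have hM := h_telescope k M.
have := h_telescope j (k + M - j); rewrite subnKC ?(ltnW jM)//.
have sD : 0 <= \sum_(j <= i < k + M) Delta i by rewrite sumr_ge0.
have sW : \sum_(j <= i < k + M) W i <= S.
  exact: ler_sum_subrange W_ge0 kj (ltnW jM) (leqnn _).
have WS : W j <= S.
  by have := ler_sum_subrange W_ge0 kj (leqnSn j) jM; rewrite big_nat1.
have BsW : 2 * B * \sum_(j <= i < k + M) W i <= 2 * B * S.
  by rewrite ler_wpM2l// mulr_ge0.
move=> hj; have hjM : h (k + M) <= h j + 2 * B * S by lra.
have LD : 0 < 2 * L * D ^+ 2 by rewrite mulr_gt0 ?exprn_gt0// mulr_gt0.
have eta0 : 0 < eta by rewrite invr_gt0 !mulr_gt0 ?exprn_gt0.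
have h1 : eta * (h (k + M) - 2 * B * S) <=
    G j ^+ 2 / (2 * L * D ^+ 2) + (2 * L * D ^+ 2)^-1 * S.
  have -> : G j ^+ 2 / (2 * L * D ^+ 2) + (2 * L * D ^+ 2)^-1 * S =
    eta * (A * (G j ^+ 2 + S)).
    by rewrite /eta; field; rewrite !gt_eqF.
  rewrite ler_pM2l//.
  have := h_gap j.
  have : A * (G j ^+ 2 + W j) <= A * (G j ^+ 2 + S).
    by rewrite ler_pM2l// lerD2l.
  lra.
rewrite -/M -/S in hdec hM.
lra.
Qed.

End window.

(** Strong induction in strides of [M]; the uniform bound on [h] serves the first [M] indices. Noise
    at [j] is damped by [al ^+ (k - j)], split as [al ^+ k] times [al ^- j] so that the summands do
    not depend on [k]. *)
Lemma geometric_unroll (R : realType) (h W : nat -> R) (M : nat)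
    (H C eta al : R) : (0 < M)%N -> 0 <= C -> 0 < eta -> 0 < al -> al <= 1 ->
  1 <= al ^+ M * (1 + eta) ->
  (forall k, 0 <= W k) -> (forall k, 0 <= h k <= al ^+ M * H) ->
  (forall k, (1 + eta) * h (k + M)%N <=
    h k + C * \sum_(k <= j < k + M) W j) ->
  forall k, h k <= al ^+ k * (H + C * \sum_(0 <= j < k) al ^- j * W j).
Proof.
move=> M0 C0 eta0 al0 al1 alM W0 hH hM.
have aW j : 0 <= al ^- j * W j by rewrite mulr_ge0// invr_ge0 exprn_ge0// ltW.
have sW k l : 0 <= \sum_(k <= j < l) al ^- j * W j by rewrite sumr_ge0.
have H0 : 0 <= H.
  have /andP[h0 h1] := hH 0%N; have := le_trans h0 h1.
  by rewrite pmulr_rge0// exprn_gt0.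
move=> k; have [n kn] := ubnP k; elim: n k kn => // n IH k kn.
have [kM|Mk] := ltnP k M.
  have /andP[_ hk] := hH k; apply: le_trans hk _.
  apply: (@le_trans _ _ (al ^+ k * H)).
    by rewrite ler_wpM2r// ler_wiXn2l ?(ltW al0)// ltnW.
  by rewrite ler_pM2l ?exprn_gt0// lerDl mulr_ge0.
have -> : k = ((k - M) + M)%N by rewrite subnK.
set i := (k - M)%N.
have ik : (i < n)%N.
  apply: leq_trans (_ : k <= n)%N => //.
  by rewrite /i ltn_subrL M0 (leq_trans M0).
have := IH i ik; set Si := \sum_(0 <= j < i) _ => hi.
have := hM i; set S := \sum_(i <= j < i + M) W j => hiM.
rewrite (big_cat_nat (leq0n i) (leq_addr M i))/= -/Si.
set Sa := \sum_(i <= j < i + M) _.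
(* Inside the window [j >= i], so [al ^+ i * al ^- j >= 1]. *)
have SSa : S <= al ^+ i * Sa.
  rewrite mulr_sumr /S !big_nat; apply: ler_sum => j /andP[ij _].
  rewrite mulrA ler_peMl// ler_pdivlMr ?exprn_gt0// mul1r.
  by rewrite ler_wiXn2l// ltW.
have /andP[hk0 _] := hH (i + M)%N.
have aM0 : 0 < al ^+ M by rewrite exprn_gt0.
have X0 : 0 <= h i + C * S.
  by apply: le_trans hiM; rewrite mulr_ge0// addr_ge0// ltW.
have h1 : h (i + M)%N <= al ^+ M * (h i + C * S).
  have e1 : h (i + M)%N <= al ^+ M * (1 + eta) * h (i + M)%N by rewrite ler_peMl.
  by apply: le_trans e1 _; rewrite -mulrA ler_pM2l.
apply: le_trans h1 _; rewrite addnC exprD -mulrA ler_pM2l//.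
have : C * S <= C * (al ^+ i * Sa) by rewrite ler_wpM2l.
lra.
Qed.

(** * Weighted averages of the component functions *)

Section mixtures.
Context {R : realType} {p n : nat}.
Variables (f : 'I_n -> 'cV[R]_p -> R) (L : 'I_n -> R).
Hypothesis f_diff : forall i (y : 'cV[R]_p), differentiable (f i) y.
Hypothesis f_lip : forall i, lipschitz_grad (L i) (f i).
Implicit Types (w : 'I_n -> R) (x y v : 'cV[R]_p).

(** Covers the sampled objective (empirical frequencies) and [F] (uniform weights) at once, so that
    the two differ by a multiple of the l1 distance of their weights. *)
Definition mix w x : R := \sum_(i < n) w i * f i x.

Definition mix_lip w : R := \sum_(i < n) w i * L i.

Lemma grad_mix w x : grad (mix w) x = \sum_(i < n) w i *: grad (f i) x.
Proof.
apply/colP => j; rewrite mxE summxE.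
have -> : mix w = \sum_(i < n) (w i *: f i).
  by apply/funext => y; rewrite /mix fct_sumE.
rewrite derive_sum; last by move=> i; apply: derivableZ; exact: diff_derivable.
by apply: eq_bigr => i _; rewrite deriveZ ?mxE//; exact: diff_derivable.
Qed.

Lemma mix_descent w x v : (forall i, 0 <= w i) ->
  mix w (x + v) <= mix w x + dot (grad (mix w) x) v +
    mix_lip w / 2 * enorm v ^+ 2.
Proof.
move=> w0; rewrite grad_mix dot_suml /mix_lip !mulr_suml -!big_split/=.
apply: ler_sum => i _; rewrite dotZl.
have := descent x v (f_diff i) (f_lip i); rewrite ler_norml => /andP[_ h].
have := ler_wpM2l (w0 i) h; lra.
Qed.

Lemma mix_grad_line w x v t : (forall i, 0 <= w i) -> 0 <= t ->
  dot (grad (mix w) (x + t *: v)) v <=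
  dot (grad (mix w) x) v + mix_lip w * t * enorm v ^+ 2.
Proof.
move=> w0 t0; rewrite !grad_mix !dot_suml /mix_lip !mulr_suml -!big_split/=.
apply: ler_sum => i _; rewrite !dotZl.
have := ler_wpM2l (w0 i) (lipschitz_grad_monotone x v (f_lip i) t0); lra.
Qed.

Lemma lipschitz_grad_mix w : (forall i, 0 <= w i) ->
  lipschitz_grad (mix_lip w) (mix w).
Proof.
move=> w0 x y; rewrite !grad_mix -sumrB /mix_lip mulr_suml.
apply: le_trans (enorm_sum _ _ _) _; apply: ler_sum => i _.
by rewrite -scalerBr enormZ ger0_norm// -mulrA ler_wpM2l//; exact: f_lip.
Qed.

Lemma mix_le_norm B w w' x : (forall i, `|f i x| <= B) ->
  `|mix w x - mix w' x| <= B * \sum_(i < n) `|w i - w' i|.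
Proof.
move=> fB; rewrite /mix -sumrB mulr_sumr.
apply: le_trans (ler_norm_sum _ _ _) _; apply: ler_sum => i _.
by rewrite -mulrBl normrM mulrC ler_wpM2r.
Qed.

Lemma grad_mix_le_norm B w w' x : (forall i, enorm (grad (f i) x) <= B) ->
  enorm (grad (mix w) x - grad (mix w') x) <= B * \sum_(i < n) `|w i - w' i|.
Proof.
move=> fB; rewrite !grad_mix -sumrB mulr_sumr.
apply: le_trans (enorm_sum _ _ _) _; apply: ler_sum => i _.
by rewrite -scalerBl enormZ mulrC ler_wpM2r.
Qed.

Lemma enorm_grad_mix B w x : (forall i, 0 <= w i) -> \sum_(i < n) w i = 1 ->
  (forall i, enorm (grad (f i) x) <= B) -> enorm (grad (mix w) x) <= B.
Proof.
move=> w0 w1 fB; rewrite grad_mix -[leRHS]mul1r -w1 mulr_suml.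
apply: le_trans (enorm_sum _ _ _) _; apply: ler_sum => i _.
by rewrite enormZ ger0_norm// ler_wpM2l.
Qed.

Lemma mix_lip_le w l : (forall i, 0 <= w i) -> \sum_(i < n) w i = 1 ->
  (forall i, L i <= l) -> mix_lip w <= l.
Proof.
move=> w0 w1 hl; rewrite -[leRHS]mul1r -w1 mulr_suml.
by apply: ler_sum => i _; rewrite ler_wpM2l.
Qed.

Lemma mix_lip_gt0 w : (forall i, 0 <= w i) -> \sum_(i < n) w i = 1 ->
  (forall i, 0 < L i) -> 0 < mix_lip w.
Proof.
move=> w0 w1 L0.
have [l l0 hl] : exists2 l, 0 < l & forall i : 'I_n, xpredT i -> l <= L i.
  exact: finite_pos_lower_bound.
apply: lt_le_trans l0 _; rewrite -[leLHS]mul1r -w1 mulr_suml.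
by apply: ler_sum => i _; rewrite ler_wpM2l// hl.
Qed.

Lemma mix_strong_convexity s w x y : (forall i, 0 <= w i) ->
  \sum_(i < n) w i = 1 -> (forall i, 0 < L i) -> 0 < s ->
  (forall i, exists2 si, s <= si & strongly_convex si (f i)) ->
  mix w x + dot (grad (mix w) x) (y - x) + s / 4 * enorm (y - x) ^+ 2
    <= mix w y.
Proof.
move=> w0 w1 L0 s0 sc.
have -> : s / 4 * enorm (y - x) ^+ 2 =
    \sum_(i < n) w i * (s / 4 * enorm (y - x) ^+ 2) by rewrite -mulr_suml w1 mul1r.
rewrite grad_mix dot_suml /mix -!big_split/=; apply: ler_sum => i _.
have [si ssi sci] := sc i.
have s0i := lt_le_trans s0 ssi.
have := strongly_convex_grad x y (f_diff i) (f_lip i) sci s0i (ltW (L0 i)).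
set e := enorm _ ^+ 2 => h.
have e0 : 0 <= e by exact: sqr_ge0.
have {}h : f i x + dot (grad (f i) x) (y - x) + s / 4 * e <= f i y by nra.
by have := ler_wpM2l (w0 i) h; rewrite dotZl; lra.
Qed.

(** The empirical frequency N_i / m_k of the index [i] in the batch. *)
Definition freq (b : nat) (s : nat -> 'I_n) (i : 'I_n) : R :=
  b%:R^-1 * \sum_(j < b) (s j == i)%:R.

Lemma freq_ge0 b s i : 0 <= freq b s i.
Proof. by rewrite mulr_ge0 ?invr_ge0// sumr_ge0. Qed.

Lemma sum_freq b s (F : 'I_n -> R) :
  \sum_(i < n) freq b s i * F i = b%:R^-1 * \sum_(j < b) F (s j).
Proof.
under eq_bigr do rewrite -mulrA mulr_suml.
rewrite -mulr_sumr exchange_big/=; congr (_ * _); apply: eq_bigr => j _.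
rewrite (bigD1 (s j))//= eqxx mul1r big1 ?addr0// => i.
by rewrite eq_sym => /negPf->; rewrite mul0r.
Qed.

Lemma sum_freq1 b s : (0 < b)%N -> \sum_(i < n) freq b s i = 1.
Proof.
move=> b0; have := sum_freq b s (fun=> 1).
under eq_bigr do rewrite mulr1.
by move=> ->; rewrite sumr_const card_ord mulVf// pnatr_eq0 -lt0n.
Qed.

Lemma batch_funE b s : batch_fun f b s = mix (freq b s).
Proof. by apply/funext => x; rewrite /mix sum_freq. Qed.

Lemma batch_lipE b s : batch_lip L b s = mix_lip (freq b s).
Proof. by rewrite /mix_lip sum_freq. Qed.

Lemma objectiveE : objective f = mix (fun=> n%:R^-1).
Proof. by apply/funext => x; rewrite /mix -mulr_sumr. Qed.

Lemma sum_unif : (0 < n)%N -> \sum_(i < n) (n%:R^-1 : R) = 1.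
Proof.
by move=> n0; rewrite sumr_const card_ord -[LHS]mulr_natr mulVf// pnatr_eq0 -lt0n.
Qed.

End mixtures.

(** If [L <= 0] the gradient is constant, so [f] is affine by [descent], against its quadratic
    growth between the distinct points [x] and [y]. *)
Lemma lipschitz_strongly_convex_gt0 (R : realType) p (f : 'cV[R]_p -> R)
    (s L : R) (x y : 'cV[R]_p) : (forall z, differentiable f z) ->
  lipschitz_grad L f -> strongly_convex s f -> 0 < s -> x != y -> 0 < L.
Proof.
move=> df lf sf s0 xy; rewrite ltNge; apply/negP => L0.
have lf0 : lipschitz_grad 0 f.
  by move=> u v; apply: le_trans (lf u v) _; rewrite ler_wpM2r ?enorm_ge0.
have h1 := strongly_convex_grad x y df lf0 sf s0 (lexx 0).
have := descent x (y - x) df lf0.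
rewrite mul0r mul0r normr_le0 (addrC x) subrK => /eqP h2.
have : 0 < s / 4 * enorm (y - x) ^+ 2.
  by rewrite mulr_gt0 ?divr_gt0// exprn_gt0// enorm_gt0// subr_eq0 eq_sym.
lra.
Qed.

(** * One step of the algorithm *)

Section weights.
Context {R : realType} {m p : nat}.
Variables (C : 'M[R]_(m, p)) (d : 'cV[R]_m).
Implicit Types (x v w : 'cV[R]_p) (mu : 'cV[R]_p -> R).

Lemma sum_indic_vertices (M : lmodType R) (F : 'cV[R]_p -> M) w :
  vertices C d w ->
  \sum_(v \in vertices C d) (v == w)%:R *: F v = F w.
Proof.
move=> Vw; rewrite sum_vertices.
rewrite (big_rem w)/=; last exact/mem_vertices.
rewrite eqxx scale1r big_seq big1 ?addr0// => v.
by rewrite (mem_rem_uniq _ (fset_uniq _)) inE => /andP[/negPf-> _]; rewrite scale0r.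
Qed.

(** Module-valued [F] serves two purposes: the constant 1 yields the total weight, the identity
    yields the represented point. *)
Lemma sum_vertices_move (M : lmodType R) (F : 'cV[R]_p -> M) mu pv uv (gam : R) :
  vertices C d pv -> vertices C d uv ->
  \sum_(v \in vertices C d) move_weight mu pv uv gam v *: F v =
  \sum_(v \in vertices C d) mu v *: F v - gam *: F uv + gam *: F pv.
Proof.
move=> Vp Vu.
rewrite -(sum_indic_vertices F Vp) -(sum_indic_vertices F Vu) !sum_vertices.
rewrite !scaler_sumr -sumrB -big_split/=; apply: eq_bigr => v _.
by rewrite !scalerA scalerDl scalerBl.
Qed.

Lemma represents_move mu x pv uv (gam : R) : represents C d mu x ->
  vertices C d pv -> vertices C d uv -> 0 <= gam <= mu uv ->
  represents C d (move_weight mu pv uv gam) (x + gam *: (pv - uv)).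
Proof.
move=> [mu0 mu1 mux] Vp Vu /andP[gam0 gam1]; split.
- move=> v Vv; rewrite /move_weight.
  have [->|_] := eqVneq v uv.
    by rewrite mulr1 addr_ge0 ?mulr_ge0// subr_ge0.
  by rewrite mulr0 subr0 addr_ge0 ?mulr_ge0// mu0.
- have := @sum_vertices_move R^o (fun=> 1) mu pv uv gam Vp Vu.
  rewrite !sum_vertices in mu1 *.
  have e nu : \sum_(v <- fset_set (vertices C d)) nu v *: (1 : R^o) =
      \sum_(v <- fset_set (vertices C d)) nu v.
    by apply: eq_bigr => v _; rewrite [LHS]mulr1.
  by rewrite !e mu1 subrK.
- rewrite (sum_vertices_move id)// mux scalerBr addrAC addrA.
  by rewrite addrAC.
Qed.

Lemma represents_eq mu nu x : (forall v, vertices C d v -> nu v = mu v) ->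
  represents C d mu x -> represents C d nu x.
Proof.
move=> e [mu0 mu1 mux]; split.
- by move=> v Vv; rewrite e ?mu0.
- by rewrite -mu1; apply: eq_fsbigr => v; rewrite inE => Vv; rewrite e.
- by rewrite -mux; apply: eq_fsbigr => v; rewrite inE => Vv; rewrite e.
Qed.

Lemma represents_vertex mu x : vertices C d x ->
  (forall v, vertices C d v -> mu v = (v == x)%:R) -> represents C d mu x.
Proof.
move=> Vx e; apply: (represents_eq e); split.
- by move=> v _.
- rewrite -[RHS](@sum_indic_vertices R^o (fun=> 1) x Vx).
  by apply: eq_fsbigr => v _; rewrite [RHS]mulr1.
- exact: (sum_indic_vertices id).
Qed.

End weights.

(** * Progress made by one iteration *)

Section step.
Context {R : realType} {m p n : nat}.
Variables (C : 'M[R]_(m, p)) (d : 'cV[R]_m).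
Variables (f : 'I_n -> 'cV[R]_p -> R) (L : 'I_n -> R) (l : R).
Variable caratheodory : bool.
Hypothesis cptP : compact (polyhedron C d).
Hypothesis nontrivP : exists y z,
  [/\ polyhedron C d y, polyhedron C d z & y != z].
Hypothesis f_diff : forall i (y : 'cV[R]_p), differentiable (f i) y.
Hypothesis f_lip : forall i, lipschitz_grad (L i) (f i).
Hypothesis L_gt0 : forall i, 0 < L i.
Hypothesis L_le : forall i, L i <= l.

Local Notation P := (polyhedron C d).
Local Notation D := (diameter C d).

Variables (b : nat) (s : nat -> 'I_n).
Hypothesis b_gt0 : (0 < b)%N.

Local Notation w := (freq b s).
Local Notation g x := (grad (mix f w) x).
Local Notation bl := (mix_lip L w).

(* With [st] the unconstrained minimiser of the quadratic upper model, the
   trial step [min st gmax] is either [st] itself or the full step. *)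
Lemma trial_step_decrease x dir (gmax st : R) : dir != 0 -> enorm dir <= D ->
  0 <= - dot (g x) dir -> 0 <= gmax ->
  st = - dot (g x) dir / (bl * enorm dir ^+ 2) ->
  (st <= gmax -> (- dot (g x) dir) ^+ 2 / (2 * l * D ^+ 2) <=
     mix f w x - mix f w (x + st *: dir)) /\
  (gmax < st -> gmax * - dot (g x) dir / 2 <=
     mix f w x - mix f w (x + gmax *: dir)).
Proof.
move=> dir0 dirD; set G := - dot _ _ => G0 gmax0 stE.
have w0 := @freq_ge0 R n b s.
have w1 : \sum_(i < n) w i = 1 :> R by exact: sum_freq1.
have bl0 : 0 < bl := mix_lip_gt0 w0 w1 L_gt0.
have bll : bl <= l := mix_lip_le w0 w1 L_le.
have e0 : 0 < enorm dir ^+ 2 by rewrite exprn_gt0// enorm_gt0.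
have desc t : 0 <= t -> t * G - bl / 2 * t ^+ 2 * enorm dir ^+ 2 <=
    mix f w x - mix f w (x + t *: dir).
  move=> t0; have := mix_descent f_diff f_lip x (t *: dir) w0.
  rewrite dotZr enormZ ger0_norm// exprMn /G; lra.
have ble : 0 < bl * enorm dir ^+ 2 by rewrite mulr_gt0.
split=> [le|]; last first.
  rewrite stE ltr_pdivlMr// => lt.
  by apply: le_trans (desc _ gmax0); nra.
have st0 : 0 <= st by rewrite stE divr_ge0// ltW.
apply: le_trans (desc _ st0).
have -> : st * G - bl / 2 * st ^+ 2 * enorm dir ^+ 2 =
    G ^+ 2 / (2 * bl * enorm dir ^+ 2).
  by rewrite stE; field; rewrite !gt_eqF// enorm_gt0.
have p1 : 0 < 2 * bl * enorm dir ^+ 2 by rewrite -mulrA mulr_gt0.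
have p2 : 0 < 2 * l * D ^+ 2.
  rewrite mulr_gt0 ?exprn_gt0//; first by rewrite mulr_gt0// (lt_le_trans bl0).
  by rewrite (lt_le_trans _ dirD)// enorm_gt0.
rewrite ler_wpM2l ?sqr_ge0// lef_pV2 ?posrE//.
rewrite -!mulrA ler_pM2l//; apply: ler_pM => //; [exact: ltW..|].
by rewrite lerXn2r ?nnegrE ?enorm_ge0// (le_trans (enorm_ge0 dir)).
Qed.

(* An exact line search that stops before [gmax] has reached [st]: otherwise
   the slope at the end point would still be negative, and by smoothness the
   function would be smaller at [gmax]. *)
Lemma line_search_full_step x dir (gmax gam : R) : dir != 0 ->
  line_search (mix f w) x dir gmax gam ->
  gmax < - dot (g x) dir / (bl * enorm dir ^+ 2) -> gam = gmax.
Proof.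
move=> dir0 [/andP[gam0 gam1] ls]; set G := - dot _ _ => lt.
have w0 := @freq_ge0 R n b s.
have w1 : \sum_(i < n) w i = 1 :> R by exact: sum_freq1.
have bl0 : 0 < bl := mix_lip_gt0 w0 w1 L_gt0.
have e0 : 0 < enorm dir ^+ 2 by rewrite exprn_gt0// enorm_gt0.
have ble : 0 < bl * enorm dir ^+ 2 by rewrite mulr_gt0.
rewrite ltr_pdivlMr// in lt.
apply/eqP; rewrite eq_le gam1/= leNgt; apply/negP => gamlt.
have h1 := ls gmax; rewrite lexx (le_trans gam0 gam1) in h1.
have {}h1 := h1 isT.
have := mix_descent f_diff f_lip (x + gam *: dir) ((gmax - gam) *: dir) w0.
rewrite -addrA -scalerDl [gam + _]addrC subrK dotZr enormZ ger0_norm ?subr_ge0//.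
rewrite exprMn => h2.
have h3 := mix_grad_line f_diff f_lip x dir w0 gam0.
set sl := dot (g (x + gam *: dir)) dir in h2 h3.
set a := gmax - gam in h2.
have a0 : 0 < a by rewrite subr_gt0.
have h4 : 0 <= a * (sl + bl / 2 * a * enorm dir ^+ 2) by lra.
rewrite pmulr_rge0// in h4.
have ae : 0 < a * (bl * enorm dir ^+ 2) by rewrite mulr_gt0.
rewrite /G /a in lt h3 h4 ae; lra.
Qed.

(** The interface of a single step for the analysis of runs. Its last clause is the dichotomy
    between good and bad steps, common to both step-size rules and both representation updates. *)
Lemma psfw_step_spec x mu pv uv (gam : R) x' mu' :
  represents C d mu x ->
  psfw_step C d f L caratheodory b s x mu pv uv gam x' mu' ->
  [/\ represents C d mu' x',
      forall v, active C d mu' v -> active C d mu v \/ v = pv,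
      0 <= gam /\ x' = x + gam *: (pv - uv),
      0 <= dot (g x) (uv - pv) &
      dot (g x) (uv - pv) ^+ 2 / (2 * l * D ^+ 2) <= mix f w x - mix f w x' \/
      [/\ gam * dot (g x) (uv - pv) / 2 <= mix f w x - mix f w x',
          ~ active C d mu' uv & uv != pv]].
Proof.
move=> rx; rewrite /psfw_step batch_funE /short_step batch_lipE.
set dir := pv - uv.
move=> [[Vp pmin] [[Vu mu_u] umax] stepE x'E repE].
have GE : dot (g x) (uv - pv) = - dot (g x) dir by rewrite -dotNr opprB.
rewrite !GE.
have G0 : 0 <= - dot (g x) dir by rewrite -GE dotBr subr_ge0 pmin//; case: Vu.
have w0 := @freq_ge0 R n b s.
have w1 : \sum_(i < n) w i = 1 :> R by exact: sum_freq1.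
have bl0 : 0 < bl := mix_lip_gt0 w0 w1 L_gt0.
have gam01 : 0 <= gam <= mu uv.
  case: stepE => [->|[]//]; case: ifPn => [_|dir0]; first by rewrite lexx ltW.
  by rewrite ge_min lexx orbT le_min divr_ge0 ?(ltW mu_u)// mulr_ge0 ?sqr_ge0 ?ltW.
have [gam0 gam1] := andP gam01.
have rx' := represents_move rx Vp Vu gam01.
have act_move v : active C d (move_weight mu pv uv gam) v ->
    active C d mu v \/ v = pv.
  rewrite /active /move_weight /= => -[Vv].
  have [->|_] := eqVneq v pv; first by right.
  rewrite mulr0 addr0 => h; left; split=> //.
  by apply: lt_le_trans h _; rewrite gerBl mulr_ge0.
(* Reweighting by Caratheodory's theorem can only shrink the active set, so facts about entering and
   dropped vertices survive it. *)
have [rmu' act'] : represents C d mu' x' /\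
    forall v, active C d mu' v -> active C d (move_weight mu pv uv gam) v.
  case: caratheodory repE => [[]|] //.
  move=> e; split; first by rewrite x'E; exact: represents_eq e rx'.
  by move=> v [Vv mv]; split=> //; rewrite -e.
split=> //; first by move=> v /act'/act_move.
(* A zero direction has zero gap and counts as a good step. *)
have [dir0|dir0] := eqVneq dir 0.
  left; rewrite x'E dir0 scaler0 addr0 subrr dot0r oppr0 expr0n.
  by rewrite /= mul0r.
rewrite (negPf dir0) in stepE.
have dirD : enorm dir <= D by apply: le_diameter => //; [case: Vp|case: Vu].
have := trial_step_decrease dir0 dirD G0 (ltW mu_u) erefl.
set st := _ / _ in stepE * => -[short full].
(* If [st] is admissible, line search does at least as well as [st]; otherwise both rules take the
   full step, which exhausts the weight of [uv]. *)
have [stle|lt] := leP st (mu uv).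
  have h := short stle; left; apply: le_trans h _; rewrite lerD2l lerN2 x'E.
  case: stepE => [->|[_ ls]]; first by rewrite min_l.
  by apply: ls; rewrite stle andbT divr_ge0// mulr_ge0 ?sqr_ge0 ?ltW.
have h := full lt; right.
have gamE : gam = mu uv.
  case: stepE => [->|ls]; first by rewrite min_r// ltW.
  exact: line_search_full_step dir0 ls lt.
have uvpv : uv != pv by rewrite eq_sym -subr_eq0.
split=> //; first by rewrite x'E gamE.
move=> /act'[_]; rewrite /move_weight eqxx (negPf uvpv) gamE.
by rewrite mulr1 mulr0 subrr addr0 ltxx.
Qed.

End step.

(** * Runs along a fixed outcome *)

Section pathwise.
Context {R : realType} {m p n : nat}.
Variables (C : 'M[R]_(m, p)) (d : 'cV[R]_m).
Variables (f : 'I_n -> 'cV[R]_p -> R) (sigma L : 'I_n -> R).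
Variable caratheodory : bool.
Hypothesis n_gt0 : (0 < n)%N.
Hypothesis cptP : compact (polyhedron C d).
Hypothesis nontrivP : exists y z,
  [/\ polyhedron C d y, polyhedron C d z & y != z].
Hypothesis vertex_ex : exists v, vertices C d v.
Hypothesis sigma_gt0 : forall i, 0 < sigma i.
Hypothesis f_sc : forall i, strongly_convex (sigma i) (f i).
Hypothesis f_diff : forall i (y : 'cV[R]_p), differentiable (f i) y.
Hypothesis f_lip : forall i, lipschitz_grad (L i) (f i).

Local Notation P := (polyhedron C d).
Local Notation D := (diameter C d).
Local Notation opt := (optimum C d f).

Lemma lipschitz_constant_gt0 i : 0 < L i.
Proof.
have [y [z [_ _ yz]]] := nontrivP.
exact: lipschitz_strongly_convex_gt0 (f_diff i) (f_lip i) (f_sc i) (sigma_gt0 i) yz.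
Qed.

Lemma LF_ge i : L i <= LF L.
Proof.
apply: ub_le_sup; last by exists i.
have [e _ he] := finite_pos_upper_bound xpredT L.
by exists e => _ [j _ <-]; exact: he.
Qed.

Lemma LF_gt0 : 0 < LF L.
Proof. exact: lt_le_trans (lipschitz_constant_gt0 (Ordinal n_gt0)) (LF_ge _). Qed.

Lemma sigmaF_le i : sigmaF sigma <= sigma i.
Proof.
apply: ge_inf; last by exists i.
by exists 0 => _ [j _ <-]; exact: ltW.
Qed.

Lemma sigmaF_gt0 : 0 < sigmaF sigma.
Proof.
have [e e0 he] : exists2 e, 0 < e & forall i : 'I_n, xpredT i -> e <= sigma i.
  exact: finite_pos_lower_bound.
apply: lt_le_trans e0 _; apply: lb_le_inf.
  by exists (sigma (Ordinal n_gt0)); exists (Ordinal n_gt0).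
by move=> _ [j _ <-]; exact: he.
Qed.

Lemma kappa_gt0 : 0 < kappa C d sigma L caratheodory.
Proof.
have O0 := Omega_gt0 cptP nontrivP vertex_ex.
have D0 := diameter_gt0 cptP nontrivP.
have N0 : 0 < (rep_size C d caratheodory)%:R :> R.
  by rewrite ltr0n /rep_size; case: ifP => // _; exact: nb_vertices_gt0.
have s0 := sigmaF_gt0; have l0 := LF_gt0.
rewrite lt_min invr_gt0 ltr0n/= divr_gt0//.
  by rewrite mulr_gt0 ?exprn_gt0.
by rewrite !mulr_gt0 ?exprn_gt0.
Qed.

(** Compare with a fixed vertex [x0]: gradients by their Lipschitz bound, values by [descent], then
    take maxima over the finitely many [i]. *)
Lemma function_grad_bound : exists2 B, 0 < B & forall x i, P x ->
  `|f i x| <= B /\ enorm (grad (f i) x) <= B.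
Proof.
have [x0 Vx0] := vertex_ex; have Px0 := Vx0.1.
pose gb i := enorm (grad (f i) x0) + L i * D.
pose fb i := `|f i x0| + gb i * D + L i / 2 * D ^+ 2.
have [e1 e10 he1] := finite_pos_upper_bound xpredT gb.
have [e2 e20 he2] := finite_pos_upper_bound xpredT fb.
have D0 := diameter_gt0 cptP nontrivP.
exists (e1 + e2); first exact: addr_gt0.
move=> x i Px; have L0 := lipschitz_constant_gt0 i.
have xD := le_diameter cptP Px Px0.
have hgb : enorm (grad (f i) x0) <= gb i by rewrite lerDl mulr_ge0 ?ltW.
split; last first.
  apply: (@le_trans _ _ (gb i)); last by rewrite (le_trans (he1 i isT))// lerDl ltW.
  rewrite -[grad _ x](subrK (grad (f i) x0)) addrC.
  apply: le_trans (enormD _ _) _; rewrite lerD2l.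
  by apply: le_trans (f_lip _ _ _) _; rewrite ler_wpM2l// ltW.
apply: (@le_trans _ _ (fb i)); last by rewrite (le_trans (he2 i isT))// lerDr ltW.
have := descent x0 (x - x0) (f_diff i) (f_lip i); rewrite (addrC x0) subrK.
have h1 : `|dot (grad (f i) x0) (x - x0)| <= gb i * D.
  rewrite ler_norml; have hh : enorm (grad (f i) x0) * enorm (x - x0) <= gb i * D.
    by apply: ler_pM; rewrite ?enorm_ge0.
  rewrite (le_trans (cauchy_schwarz _ _) hh) andbT.
  by rewrite (le_trans _ (dot_geN _ _))// lerN2.
have h2 : L i / 2 * enorm (x - x0) ^+ 2 <= L i / 2 * D ^+ 2.
  rewrite ler_wpM2l ?divr_ge0 ?(ltW L0)//.
  by rewrite lerXn2r ?nnegrE ?enorm_ge0// ltW.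
move=> /le_trans/(_ h2); set a := f i x - _ - _ => h3.
have -> : f i x = f i x0 + dot (grad (f i) x0) (x - x0) + a by rewrite /a; ring.
by rewrite /fb (le_trans (ler_normD _ _))// lerD// (le_trans (ler_normD _ _))// lerD2l.
Qed.

Variable B : R.
Hypothesis B_gt0 : 0 < B.
Hypothesis B_bound : forall x i, P x ->
  `|f i x| <= B /\ enorm (grad (f i) x) <= B.

Let fB x i : P x -> `|f i x| <= B.
Proof. by move=> /(B_bound i)[]. Qed.
Let gB x i : P x -> enorm (grad (f i) x) <= B.
Proof. by move=> /(B_bound i)[]. Qed.

Let unif_ge0 (i : 'I_n) : 0 <= (n%:R^-1 : R). Proof. by rewrite invr_ge0. Qed.
Let unif1 : \sum_(i < n) (n%:R^-1 : R) = 1. Proof. exact: sum_unif. Qed.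

Lemma objective_bound x : P x -> `|objective f x| <= B.
Proof.
move=> Px; rewrite objectiveE -[leRHS]mul1r -[X in _ <= X * _]unif1 mulr_suml.
apply: le_trans (ler_norm_sum _ _ _) _; apply: ler_sum => i _.
by rewrite normrM ger0_norm// ler_wpM2l// fB.
Qed.

Lemma optimum_le x : P x -> opt <= objective f x.
Proof.
move=> Px; apply: ge_inf; last by exists x.
exists (- B) => _ [y Py <-].
by have := objective_bound Py; rewrite ler_norml => /andP[].
Qed.

Lemma le_optimum e : (forall y, P y -> e <= objective f y) -> e <= opt.
Proof.
move=> he; have [v [Pv _]] := vertex_ex.
by apply: lb_le_inf; [exists (objective f v), v|move=> _ [y Py <-]; exact: he].
Qed.

(** The sampling noise W_k: the l1 distance between empirical and uniform weights. *)
Definition noise (b : nat) (s : nat -> 'I_n) : R :=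
  \sum_(i < n) `|freq b s i - n%:R^-1|.

Lemma noise_ge0 b s : 0 <= noise b s.
Proof. exact: sumr_ge0. Qed.

Lemma noise_le2 b s : (0 < b)%N -> noise b s <= 2.
Proof.
move=> b0; have -> : 2 = \sum_(i < n) (freq b s i + n%:R^-1) :> R.
  by rewrite big_split/= sum_freq1// unif1.
apply: ler_sum => i _; rewrite (le_trans (ler_normB _ _))//.
by rewrite !ger0_norm ?freq_ge0.
Qed.

Local Notation g b s x := (grad (mix f (freq b s)) x).
Local Notation c0 := (Omega C d / (nb_vertices C d)%:R).
Local Notation A := (2 / (c0 ^+ 2 * sigmaF sigma) + 4 * B ^+ 2 / sigmaF sigma).

Let c0_gt0 : 0 < c0.
Proof.
have O := Omega_gt0 cptP nontrivP vertex_ex.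
by rewrite divr_gt0// ltr0n; exact: nb_vertices_gt0.
Qed.

Lemma gap_constant_gt0 : 0 < A.
Proof.
have s0 := sigmaF_gt0.
apply: addr_gt0; apply: divr_gt0 => //; apply: mulr_gt0 => //.
  exact: exprn_gt0.
exact: exprn_gt0.
Qed.

(** For arbitrary feasible [y], strong convexity bounds F(x) - F(y) by a slope term minus
    [sigmaF / 4 * r^2]. The slope is passed to the sampled gradient at a noise cost and then bounded
    by [pairwise_gap_ge]; it remains to maximise over the distance [r]. *)
Lemma optimality_gap_le b s x mu (pv uv : 'cV[R]_p) : (0 < b)%N ->
  represents C d mu x ->
  (forall y, P y -> dot (g b s x) pv <= dot (g b s x) y) ->
  (forall v, active C d mu v -> dot (g b s x) v <= dot (g b s x) uv) ->
  objective f x - opt <= A * (dot (g b s x) (uv - pv) ^+ 2 + noise b s).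
Proof.
move=> b0 rx hp hu; have Px := polyhedron_represents rx.
set G := dot (g b s x) (uv - pv); set W := noise b s.
have W0 : 0 <= W := noise_ge0 b s.
have s0 := sigmaF_gt0.
rewrite lerBlDr -lerBlDl; apply: le_optimum => y Py.
have hsc : objective f x + dot (grad (objective f) x) (y - x) +
    sigmaF sigma / 4 * enorm (y - x) ^+ 2 <= objective f y.
  rewrite objectiveE; apply: mix_strong_convexity => //.
    exact: lipschitz_constant_gt0.
  by move=> i; exists (sigma i) => //; exact: sigmaF_le.
rewrite enorm_distC -(opprB x y) dotNr in hsc.
set r := enorm (x - y) in hsc.
have hW : dot (grad (objective f) x) (x - y) <= dot (g b s x) (x - y) + B * W * r.
  rewrite -lerBlDl -dotBl; apply: le_trans (cauchy_schwarz _ _) _.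
  rewrite ler_wpM2r ?enorm_ge0// enorm_distC objectiveE.
  by apply: grad_mix_le_norm => // i; exact: gB.
have hgap : c0 * dot (g b s x) (x - y) <= G * r.
  rewrite /G (dotBr _ uv).
  exact: (pairwise_gap_ge cptP nontrivP vertex_ex rx Py hp hu).
have {}hgap : dot (g b s x) (x - y) <= G / c0 * r.
  by rewrite mulrAC ler_pdivlMr// mulrC.
set a := G / c0 + B * W.
have h1 : objective f x - objective f y <= a * r - sigmaF sigma / 4 * r ^+ 2.
  by rewrite /a; lra.
have h2 : a * r - sigmaF sigma / 4 * r ^+ 2 <= a ^+ 2 / sigmaF sigma.
  rewrite ler_pdivlMr// -subr_ge0.
  have -> : a ^+ 2 - (a * r - sigmaF sigma / 4 * r ^+ 2) * sigmaF sigma =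
    (a - sigmaF sigma * r / 2) ^+ 2 by field.
  exact: sqr_ge0.
(* The squared noise is made linear by [W <= 2]. *)
have h3 : a ^+ 2 <= 2 * (G / c0) ^+ 2 + 4 * B ^+ 2 * W.
  have : W * W <= 2 * W by rewrite ler_wpM2r// noise_le2.
  have := sqr_ge0 (G / c0 - B * W).
  have : 0 <= B ^+ 2 by exact: sqr_ge0.
  rewrite /a; nra.
have h4 : a ^+ 2 / sigmaF sigma <= A * (G ^+ 2 + W).
  rewrite ler_pdivrMr//; apply: le_trans h3 _.
  have -> : A * (G ^+ 2 + W) * sigmaF sigma =
     2 * (G / c0) ^+ 2 + 4 * B ^+ 2 * W + (2 / c0 ^+ 2 * W + 4 * B ^+ 2 * G ^+ 2).
    field; rewrite !gt_eqF// ?Omega_gt0// ltr0n; exact: nb_vertices_gt0.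
  rewrite lerDl; apply: addr_ge0; apply: mulr_ge0; rewrite ?sqr_ge0//.
    by rewrite divr_ge0 ?sqr_ge0.
  by rewrite mulr_ge0 ?sqr_ge0.
rewrite lerBlDr -lerBlDl; exact: le_trans h1 (le_trans h2 h4).
Qed.

(** Runs are indexed from 0 here: entry [k] will be instantiated with iteration [k.+1]. *)
Variables (x : nat -> 'cV[R]_p) (mu : nat -> 'cV[R]_p -> R).
Variables (pv uv : nat -> 'cV[R]_p) (gam : nat -> R).
Variables (b : nat -> nat) (s : nat -> nat -> 'I_n).
Hypothesis b_gt0 : forall k, (0 < b k)%N.
Hypothesis x0_vertex : vertices C d (x 0%N).
Hypothesis mu0E : forall v, vertices C d v -> mu 0%N v = (v == x 0%N)%:R.
Hypothesis stepP : forall k, psfw_step C d f L caratheodory (b k) (s k) (x k) (mu k)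
  (pv k) (uv k) (gam k) (x k.+1) (mu k.+1).

Lemma run_represents k : represents C d (mu k) (x k).
Proof.
elim: k => [|k rk]; first exact: represents_vertex.
by have [] := psfw_step_spec cptP f_diff f_lip lipschitz_constant_gt0 LF_ge
  (b_gt0 k) rk (stepP k).
Qed.

Lemma run_polyhedron k : P (x k).
Proof. exact: polyhedron_represents (run_represents k). Qed.

Let spec k := psfw_step_spec cptP f_diff f_lip lipschitz_constant_gt0 LF_ge
  (b_gt0 k) (run_represents k) (stepP k).

Let pP k : P (pv k). Proof. by have [[[]]] := stepP k. Qed.
Let uV k : vertices C d (uv k). Proof. by have [_ [[]]] := stepP k. Qed.

Let pmin k y : P y ->
  dot (g (b k) (s k) (x k)) (pv k) <= dot (g (b k) (s k) (x k)) y.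
Proof. by have [[_ +] _ _ _ _] := stepP k; rewrite batch_funE => h Py; exact: h. Qed.

Let umax k v : active C d (mu k) v ->
  dot (g (b k) (s k) (x k)) v <= dot (g (b k) (s k) (x k)) (uv k).
Proof. by have [_ [_ +] _ _ _] := stepP k; rewrite batch_funE; exact. Qed.

Lemma run_displacement i l : (i <= l)%N ->
  enorm (x i - x l) <= D * \sum_(i <= j < l) gam j.
Proof.
elim: l => [|l IH].
  by rewrite leqn0 => /eqP->; rewrite subrr enorm0 big_geq// mulr0.
rewrite leq_eqVlt => /predU1P[->|il]; first by rewrite subrr enorm0 big_geq// mulr0.
have [_ _ [gam0 ->] _ _] := spec l.
rewrite big_nat_recr//= mulrDr opprD addrA.
apply: le_trans (enormD _ _) _; apply: lerD; first exact: IH.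
rewrite enormN enormZ ger0_norm// mulrC ler_wpM2r//.
by apply: le_diameter => //; case: (uV l).
Qed.

(** At time [l] the vertex [uv i] minimises the sampled gradient, so the slope along [uv i - pv i]
    is nonpositive there, and the gap at [i] is at most [D] times the change of the sampled
    gradient. That change splits into two noise terms and the change of the true gradient along the
    displacement. *)
Lemma run_reentry i l : (i < l)%N -> uv i = pv l ->
  dot (g (b i) (s i) (x i)) (uv i - pv i) <=
  D * (LF L * D * (\sum_(i <= j < l) gam j) +
       B * (noise (b i) (s i) + noise (b l) (s l))).
Proof.
move=> il uE; have D0 := diameter_gt0 cptP nontrivP.
set gi := g (b i) (s i) (x i); set gl := g (b l) (s l) (x l).
have h1 : dot gl (uv i - pv i) <= 0 by rewrite uE dotBr subr_le0; exact: pmin.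
have h2 : dot gi (uv i - pv i) <= dot (gi - gl) (uv i - pv i) by rewrite dotBl; lra.
apply: le_trans h2 _; apply: le_trans (cauchy_schwarz _ _) _.
rewrite mulrC; apply: ler_pM; rewrite ?enorm_ge0//.
  by apply: le_diameter => //; case: (uV i).
have hi : enorm (gi - grad (objective f) (x i)) <= B * noise (b i) (s i).
  rewrite objectiveE; apply: grad_mix_le_norm => // j; apply: gB; exact: run_polyhedron.
have hl : enorm (gl - grad (objective f) (x l)) <= B * noise (b l) (s l).
  rewrite objectiveE; apply: grad_mix_le_norm => // j; apply: gB; exact: run_polyhedron.
have hil : enorm (grad (objective f) (x i) - grad (objective f) (x l)) <=
    LF L * D * \sum_(i <= j < l) gam j.
  rewrite objectiveE; apply: le_trans (lipschitz_grad_mix f_diff f_lip _ _ _) _ => //.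
  rewrite -mulrA; apply: ler_pM => //; rewrite ?enorm_ge0//.
  - by rewrite ltW// mix_lip_gt0//; exact: lipschitz_constant_gt0.
  - by apply: mix_lip_le => //; exact: LF_ge.
  - exact: run_displacement (ltnW il).
have split3 (a1 a2 a3 a4 : 'cV[R]_p) : a1 - a4 = (a1 - a2) + ((a2 - a3) - (a4 - a3)).
  by rewrite opprB [a2 - a3 + _]addrA subrK addrA subrK.
rewrite (split3 _ (grad (objective f) (x i)) (grad (objective f) (x l))).
rewrite -enormN in hl.
apply: le_trans (enormD _ _) _.
apply: le_trans (lerD hi (le_trans (enormD _ _) (lerD hil hl))) _.
by rewrite mulrDr addrCA.
Qed.

Local Notation V := (fset_set (vertices C d)).
Local Notation l := (LF L).
Local Notation eta := (2 * A * l * D ^+ 2)^-1.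

Lemma run_contraction k : (1 + eta) * (objective f (x (k + (size V).+1)%N) - opt) <=
  (objective f (x k) - opt) +
  (2 * B + 2 * B * eta + (2 * l * D ^+ 2)^-1 + B ^+ 2 / (2 * l)) *
    \sum_(k <= j < k + (size V).+1) noise (b j) (s j).
Proof.
pose h k := objective f (x k) - opt.
pose G k := dot (g (b k) (s k) (x k)) (uv k - pv k).
pose Delta k := mix f (freq (b k) (s k)) (x k) - mix f (freq (b k) (s k)) (x k.+1).
pose W k := noise (b k) (s k).
have D0 := diameter_gt0 cptP nontrivP.
apply: (@window_contraction R _ V uv pv (fun k v => active C d (mu k) v) h Delta G W gam
  A B D l) => //.
- exact: gap_constant_gt0.
- exact: ltW.
- exact: LF_gt0.
- by move=> j; apply/mem_vertices.
- by move=> j; have [_ [[]]] := stepP j.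
- by move=> j v; have [_ + _ _ _] := spec j; exact.
- by move=> j; exact: noise_ge0.
- by move=> j; have [_ _ [] ] := spec j.
- move=> j; have [_ _ _ -> _] := spec j; rewrite /= /G.
  apply: le_trans (cauchy_schwarz _ _) _; apply: ler_pM; rewrite ?enorm_ge0//.
    apply: enorm_grad_mix => //; first exact: freq_ge0.
      exact: sum_freq1.
    by move=> i; apply: gB; exact: run_polyhedron.
  by apply: le_diameter => //; case: (uV j).
(* Sampled and true objective differ by at most [B * W j] at each end of the step, whence the factor
   2. *)
- move=> j; rewrite /h /Delta /W.
  have d1 := @mix_le_norm R p n f B (freq (b j) (s j)) (fun=> n%:R^-1) (x j)
    (fun i => fB i (run_polyhedron j)).
  have d2 := @mix_le_norm R p n f B (freq (b j) (s j)) (fun=> n%:R^-1) (x j.+1)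
    (fun i => fB i (run_polyhedron j.+1)).
  rewrite -objectiveE ler_norml -/(noise _ _) in d1.
  rewrite -objectiveE ler_norml -/(noise _ _) in d2.
  move: d1 d2 => /andP[_ d1] /andP[d2 _]; lra.
- move=> j; apply: optimality_gap_le => //; first exact: run_represents.
    exact: pmin.
  exact: umax.
- by move=> j; have [_ _ _ _] := spec j.
- exact: run_reentry.
Qed.

End pathwise.

(** * Sampling noise *)

Section probability_bounds.
Context {disp : measure_display} {T : measurableType disp} {R : realType}.
Variable Pr : probability T R.
Local Open Scope ereal_scope.

(* Unlike [ge0_le_integral], this does not require the dominated function to
   be measurable. *)
Lemma expectation_le_pointwise (X Y : T -> R) :
  (forall t, 0 <= X t <= Y t)%R -> 'E_Pr[X] <= 'E_Pr[Y].
Proof.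
move=> XY; rewrite unlock !ge0_integralTE; last 2 first.
- by move=> t; rewrite lee_fin; have /andP[h1 h2] := XY t; exact: le_trans h2.
- by move=> t; rewrite lee_fin; have /andP[] := XY t.
apply: ereal_sup_le => _ [h hX <-]; exists h => // t /=.
by apply: le_trans (hX t) _; rewrite lee_fin; have /andP[] := XY t.
Qed.

Lemma expectationD_ge0 (X Y : T -> R) : measurable_fun setT X ->
  measurable_fun setT Y -> (forall t, 0 <= X t)%R -> (forall t, 0 <= Y t)%R ->
  'E_Pr[fun t => (X t + Y t)%R] = 'E_Pr[X] + 'E_Pr[Y].
Proof.
move=> mX mY X0 Y0; rewrite unlock -ge0_integralD//.
- by move=> t _; rewrite lee_fin.
- exact/measurable_EFinP.
- by move=> t _; rewrite lee_fin.
- exact/measurable_EFinP.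
Qed.

Lemma expectationZ_ge0 (X : T -> R) (c : R) : measurable_fun setT X ->
  (forall t, 0 <= X t)%R -> (0 <= c)%R ->
  'E_Pr[fun t => (c * X t)%R] = c%:E * 'E_Pr[X].
Proof.
move=> mX X0 c0; rewrite unlock -ge0_integralZl//.
- exact/measurable_EFinP.
- by move=> t _; rewrite lee_fin.
Qed.

Lemma expectation_sum_ge0 (I : Type) (r : seq I) (X : I -> T -> R) :
  (forall i, measurable_fun setT (X i)) -> (forall i t, 0 <= X i t)%R ->
  'E_Pr[fun t => (\sum_(i <- r) X i t)%R] = \sum_(i <- r) 'E_Pr[X i].
Proof.
move=> mX X0; rewrite unlock -ge0_integral_sum//.
- by apply: eq_integral => t _; rewrite sumEFin.
- by move=> i; exact/measurable_EFinP.
- by move=> i t _; rewrite lee_fin.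
Qed.

(** The average of [N] pairwise independent indicators of probability [q] has variance q (1 - q) /
    N. *)
Lemma expectation_sqr_freq (N : nat) (A : nat -> set T) (q : R) :
  (0 < N)%N -> (0 <= q)%R ->
  (forall j, (j < N)%N -> measurable (A j)) ->
  (forall j, (j < N)%N -> Pr (A j) = q%:E) ->
  (forall i j, (i < N)%N -> (j < N)%N -> i != j ->
    Pr (A i `&` A j) = (q * q)%:E) ->
  'E_Pr[fun t => ((N%:R^-1 * \sum_(j < N) \1_(A j) t - q) ^+ 2)%R] <=
  (N%:R^-1)%:E.
Proof.
move=> N0 q0 mA PA PAA.
pose X (t : T) : R := (N%:R^-1 * \sum_(j < N) \1_(A j) t)%R.
have NR : (0 < N%:R :> R)%R by rewrite ltr0n.
have mA1 (j : 'I_N) : measurable_fun setT (\1_(A j) : T -> R).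
  by apply: measurable_indic; exact: mA.
have mS : measurable_fun setT (fun t => \sum_(j < N) \1_(A j) t : R)%R.
  exact: measurable_sum.
have mX : measurable_fun setT X by exact: measurable_funM.
have S0 t : (0 <= \sum_(j < N) \1_(A j) t :> R)%R by rewrite sumr_ge0.
have X0 t : (0 <= X t)%R by rewrite mulr_ge0// invr_ge0.
have mX2 : measurable_fun setT (fun t => X t ^+ 2)%R by exact: measurable_funX.
have mZ : measurable_fun setT (fun t => (X t - q) ^+ 2)%R.
  by apply: measurable_funX; exact: measurable_funB.
have EX : 'E_Pr[X] = q%:E.
  rewrite expectationZ_ge0 ?invr_ge0 ?ltW//.
  rewrite expectation_sum_ge0//.
  rewrite (eq_bigr (fun=> q%:E)); last first.
    move=> j _; rewrite -(PA _ (ltn_ord j)).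
    exact: expectation_indic (mA _ (ltn_ord j)).
  by rewrite sumEFin -EFinM sumr_const card_ord -[(q *+ N)%R]mulr_natl mulKf// gt_eqF.
have EX2 : 'E_Pr[fun t => (X t ^+ 2)%R] =
    (N%:R^-1 * q + (N%:R - 1) / N%:R * q ^+ 2)%:E.
  have -> : (fun t => (X t ^+ 2)%R) = (fun t => (N%:R^-1 ^+ 2) *
      \sum_(i < N) \sum_(j < N) \1_(A i `&` A j) t)%R.
    apply/funext => t; rewrite exprMn; congr (_ * _)%R; rewrite expr2 mulr_suml.
    apply: eq_bigr => i _; rewrite mulr_sumr; apply: eq_bigr => j _.
    by rewrite indicI.
  have mAA (i j : 'I_N) : measurable_fun setT (\1_(A i `&` A j) : T -> R).
    by apply: measurable_indic; apply: measurableI; exact: mA.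
  have mSS (i : 'I_N) :
      measurable_fun setT (fun t => \sum_(j < N) \1_(A i `&` A j) t : R)%R.
    exact: measurable_sum.
  rewrite expectationZ_ge0 ?sqr_ge0//; last 2 first.
    exact: measurable_sum.
    by move=> t; rewrite sumr_ge0// => i _; rewrite sumr_ge0.
  rewrite expectation_sum_ge0//; last by move=> i t; rewrite sumr_ge0.
  have -> : \sum_(i < N) 'E_Pr[fun t => (\sum_(j < N) \1_(A i `&` A j) t)%R] =
     \sum_(i < N) (q + (N%:R - 1) * q ^+ 2)%:E.
    apply: eq_bigr => i _; rewrite expectation_sum_ge0//.
    rewrite (bigD1 i)//= setIid (expectation_indic _ (mA _ (ltn_ord i))) PA//.
    rewrite (eq_bigr (fun=> (q * q)%:E)); last first.
      move=> j ji; rewrite -(PAA _ _ (ltn_ord i) (ltn_ord j)) 1?eq_sym//.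
      by apply: expectation_indic; apply: measurableI; exact: mA.
    rewrite sumEFin -EFinD; congr (_ + _)%:E.
    rewrite sumr_const cardC1 card_ord -[LHS]mulr_natl -expr2.
    by rewrite -subn1 natrB.
  rewrite sumEFin -EFinM sumr_const card_ord -[(_ *+ N)%R]mulr_natl; congr (_%:E).
  by field; rewrite gt_eqF.
(* The identity (X - q)^2 + 2 q X = X^2 + q^2 has only nonnegative terms, so extended-real
   expectations can be added; it also shows that the variance is finite. *)
have key : 'E_Pr[fun t => ((X t - q) ^+ 2)%R] + (2 * q * q)%:E =
    (N%:R^-1 * q + (N%:R - 1) / N%:R * q ^+ 2 + q ^+ 2)%:E.
  rewrite [(2 * q * q)%:E]EFinM -EX -expectationZ_ge0//; last by rewrite mulr_ge0.
  rewrite -expectationD_ge0//; last 3 first.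
  - exact: measurable_funM.
  - by move=> t; exact: sqr_ge0.
  - by move=> t; rewrite !mulr_ge0.
  rewrite EFinD -EX2 -[(q ^+ 2)%:E](expectation_cst Pr) -expectationD_ge0//; last first.
  - by move=> t; exact: sqr_ge0.
  - by move=> t; exact: sqr_ge0.
  by congr ('E_Pr[_]); apply/funext => t /=; ring.
have fin : 'E_Pr[fun t => ((X t - q) ^+ 2)%R] \is a fin_num.
  have := @ltry R (N%:R^-1 * q + (N%:R - 1) / N%:R * q ^+ 2 + q ^+ 2).
  rewrite -key => h; rewrite ge0_fin_numE; last first.
    by apply: expectation_ge0 => t; exact: sqr_ge0.
  by apply: le_lt_trans h; rewrite leeDl// lee_fin !mulr_ge0.
have q1 : (q <= 1)%R.
  by rewrite -lee_fin -(PA 0%N N0); exact/probability_le1/mA.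
move: key; rewrite -(fineK fin) -EFinD => -[key].
rewrite lee_fin.
have -> : fine 'E_Pr[fun t => ((X t - q) ^+ 2)%R] = (N%:R^-1 * (q - q ^+ 2))%R.
  apply: (addIr (2 * q * q)%R); rewrite key; field; by rewrite gt_eqF.
by rewrite ler_piMr ?invr_ge0//; nra.
Qed.

End probability_bounds.

Lemma bernoulli_le (R : realType) (e : R) k : 0 <= e <= 1 ->
  1 - k%:R * e <= (1 - e) ^+ k.
Proof.
move=> /andP[e0 e1]; elim: k => [|k IH]; first by rewrite mul0r subr0 expr0.
have k0 : 0 <= k%:R :> R by [].
have e1' : 0 <= 1 - e by rewrite subr_ge0.
rewrite exprS; have := ler_wpM2l e1' IH; rewrite -natr1; nra.
Qed.

Lemma sum_geometric_le (R : realType) (r : R) k : 0 <= r < 1 ->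
  \sum_(0 <= j < k) r ^+ j <= (1 - r)^-1.
Proof.
move=> /andP[r0 r1]; have r1' : 0 < 1 - r by rewrite subr_gt0.
rewrite -[leRHS]mul1r ler_pdivlMr// big_mkord mulrC -opprB mulNr -subrX1 opprB.
by rewrite gerBl exprn_ge0.
Qed.

Lemma expectation_affine_le (disp : measure_display) (T : measurableType disp)
    (R : realType) (Pr : probability T R) (I : Type) (r : seq I) (a : R)
    (c y : I -> R) (Y : I -> T -> R) : 0 <= a -> (forall i, 0 <= c i) ->
  (forall i, measurable_fun setT (Y i)) -> (forall i t, 0 <= Y i t) ->
  (forall i, ('E_Pr[Y i] <= (y i)%:E)%E) ->
  ('E_Pr[fun t => (a + \sum_(i <- r) c i * Y i t)%R] <=
    (a + \sum_(i <- r) c i * y i)%:E)%E.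
Proof.
move=> a0 c0 mY Y0 EY.
have mcY i : measurable_fun setT (fun t => c i * Y i t) by exact: measurable_funM.
have cY0 i t : 0 <= c i * Y i t by rewrite mulr_ge0.
rewrite expectationD_ge0//; last 2 first.
- exact: measurable_sum.
- by move=> t; rewrite sumr_ge0.
rewrite expectation_cst EFinD leeD2l// expectation_sum_ge0// -sumEFin.
apply: lee_sum => i _.
by rewrite expectationZ_ge0// EFinM lee_wpmul2l// lee_fin.
Qed.

(** * Batch sizes and moments of the empirical frequencies *)

Section draws.
Context {R : realType} {m p n : nat}.
Variables (C : 'M[R]_(m, p)) (d : 'cV[R]_m) (sigma L : 'I_n -> R).
Variable caratheodory : bool.
Local Notation kap := (kappa C d sigma L caratheodory).
Local Notation bs := (batch_size C d sigma L caratheodory).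

Lemma kappa_le2V : kap <= 2^-1.
Proof. by rewrite ge_min lexx. Qed.

Let kap1 : 0 < 1 - kap.
Proof. by have := kappa_le2V; lra. Qed.

(** The bound is written as a square because its root is the scale used in [noise_majorant]. *)
Lemma batch_size_bound k : (0 < bs k)%N /\
  ((bs k)%:R^-1 : R) <= ((1 - kap) ^+ k.+1) ^+ 2.
Proof.
have y0 : 0 < (1 - kap) ^+ (2 * k + 2) by rewrite exprn_gt0.
have N0 : ((1 - kap) ^+ (2 * k + 2))^-1 <= (bs k)%:R.
  apply: le_trans (ceil_ge _) _.
  by rewrite /batch_size natr_absz ler_int ler_norm.
have bs0 : 0 < (bs k)%:R :> R by rewrite (lt_le_trans _ N0)// invr_gt0.
split; first by rewrite -(ltr0n R).
rewrite -exprM mulnC mulnS addnC -[leRHS]invrK lef_pV2 ?posrE ?invr_gt0//.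
Qed.

Context {disp : measure_display} {T : measurableType disp}.
Variables (Pr : probability T R) (G : nat -> set (set T)).
Variables (xi : nat -> nat -> T -> 'I_n).
Variables (x : nat -> T -> 'cV[R]_p) (mu : nat -> T -> 'cV[R]_p -> R).
Variables (pv uv : nat -> T -> 'cV[R]_p) (gam : nat -> T -> R).
Hypothesis filt : filtration G.
Hypothesis adapt : adapted C d sigma L caratheodory G xi x mu pv uv gam.
Hypothesis unif : uniform_draws C d sigma L caratheodory Pr xi.
Hypothesis indep : independent_draws C d sigma L caratheodory Pr G xi.

Lemma measurable_draw k j i : (0 < k)%N -> (j < bs k)%N ->
  measurable (xi k j @^-1` [set i]).
Proof.
move=> k0 jk; have [_ sub _] := filt k.+1; apply: sub.
by have [_ + _ _ _] := adapt k0; exact.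
Qed.

Lemma draws_pairwise_independent k a b i : (0 < k)%N ->
  (a < bs k)%N -> (b < bs k)%N -> a != b ->
  Pr ((xi k a @^-1` [set i]) `&` (xi k b @^-1` [set i])) =
  (n%:R^-1 * n%:R^-1)%:E.
Proof.
move=> k0 ak bk ab.
have GT : G k setT.
  by have [[G0 GC _] _ _] := filt k; rewrite -(setD0 setT); exact: GC.
(* Full sets at the other draws reduce the product rule for the batch to two factors. *)
pose B j : set 'I_n := if (j == a) || (j == b) then [set i] else setT.
have -> : (xi k a @^-1` [set i]) `&` (xi k b @^-1` [set i]) =
    setT `&` \bigcap_(j < bs k) (xi k j @^-1` B j).
  rewrite setTI; apply/seteqP; split => t /=.
    move=> [ta tb] j _ /=; rewrite /B.
    by have [->|ja] := eqVneq j a; [|have [->|jb] := eqVneq j b].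
  move=> h; split.
    by have := h a ak; rewrite /= /B eqxx.
  by have := h b bk; rewrite /= /B eqxx orbT.
rewrite (indep B k0 GT) probability_setT mul1e.
rewrite (bigD1 (Ordinal ak))//= (bigD1 (Ordinal bk))/=; last first.
  by rewrite -val_eqE /= eq_sym.
rewrite /B !eqxx orbT/= !unif// big1 ?mule1//.
move=> j /andP[ja jb]; rewrite -!val_eqE /= in ja jb.
by rewrite (negPf ja) (negPf jb)/= preimage_setT probability_setT.
Qed.

Local Notation Z k i t := (freq (bs k) (fun j => xi k j t) i - n%:R^-1).

Let ZE k i t : Z k i t = (bs k)%:R^-1 *
  (\sum_(j < bs k) \1_(xi k j @^-1` [set i]) t) - n%:R^-1 :> R.
Proof.
congr (_ * _ - _); apply: eq_bigr => j _; rewrite indicE; congr (_%:R).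
congr nat_of_bool; apply/eqP/idP; first by move=> e; rewrite inE.
by rewrite inE.
Qed.

Lemma measurable_freq k i : (0 < k)%N ->
  measurable_fun setT (fun t => Z k i t ^+ 2 : R).
Proof.
move=> k0; under eq_fun do rewrite ZE.
apply: measurable_funX; apply: measurable_funB => //.
apply: measurable_funM => //; apply: measurable_sum => j.
exact/measurable_indic/measurable_draw.
Qed.

Lemma expectation_freq k i : (0 < k)%N ->
  ('E_Pr[fun t => (Z k i t ^+ 2)%R] <= (((1 - kap) ^+ k.+1) ^+ 2)%:E)%E.
Proof.
move=> k0; have [bs0 bsb] := batch_size_bound k.
apply: (@le_trans _ _ ((bs k)%:R^-1)%:E); last by rewrite lee_fin.
under eq_fun do rewrite ZE.
apply: (@expectation_sqr_freq _ _ _ Pr _ (fun j => xi k j @^-1` [set i])) => //.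
- by move=> j jk; exact: measurable_draw.
- by move=> j jk; exact: unif.
- by move=> a b ak bk ab; exact: draws_pairwise_independent.
Qed.

(* Majorises [noise] by AM-GM, |Z| <= lam / 2 + Z ^ 2 / (2 lam), with a
   measurable bound whose expectation only involves second moments. *)
Definition noise_majorant k (t : T) : R := let lam := (1 - kap) ^+ k.+1 in
  n%:R * lam / 2 + \sum_(i < n) (2 * lam)^-1 * Z k i t ^+ 2.

Let lam_gt0 k : 0 < (1 - kap) ^+ k.
Proof. by rewrite exprn_gt0. Qed.

Lemma noise_le_majorant k t :
  noise (bs k) (fun j => xi k j t) <= noise_majorant k t.
Proof.
rewrite /noise_majorant; set lam := _ ^+ _; have l0 : 0 < lam by exact: lam_gt0.
have -> : n%:R * lam / 2 = \sum_(i < n) lam / 2.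
  by rewrite sumr_const card_ord -[RHS]mulr_natl mulrA.
rewrite -big_split/=; apply: ler_sum => i _; set z := _ - _.
rewrite -[z ^+ 2]real_normK ?num_real// -subr_ge0.
have -> : lam / 2 + (2 * lam)^-1 * `|z| ^+ 2 - `|z| =
  (2 * lam)^-1 * (lam - `|z|) ^+ 2 by field; rewrite gt_eqF.
by rewrite mulr_ge0 ?sqr_ge0// invr_ge0 mulr_ge0// ltW.
Qed.

Lemma noise_majorant_ge0 k t : 0 <= noise_majorant k t.
Proof. exact: le_trans (noise_ge0 _ _) (noise_le_majorant _ _). Qed.

Lemma measurable_noise_majorant k : (0 < k)%N ->
  measurable_fun setT (noise_majorant k).
Proof.
move=> k0; apply: measurable_funD => //; apply: measurable_sum => i.
by apply: measurable_funM => //; exact: measurable_freq.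
Qed.

(** Since [lam ^+ 2] bounds the second moments, each of the two parts of the majorant contributes at
    most [n * lam / 2]. *)
Lemma expectation_noise_majorant k : (0 < k)%N ->
  ('E_Pr[noise_majorant k] <= (n%:R * (1 - kap) ^+ k.+1)%:E)%E.
Proof.
move=> k0; rewrite /noise_majorant; set lam := _ ^+ _.
have l0 : 0 < lam by exact: lam_gt0.
apply: le_trans (expectation_affine_le _ (y := fun=> lam ^+ 2) _ _ _ _ _) _.
- by rewrite divr_ge0// mulr_ge0// ltW.
- by move=> i; rewrite invr_ge0 mulr_ge0// ltW.
- by move=> i; exact: measurable_freq.
- by move=> i t; exact: sqr_ge0.
- by move=> i; exact: expectation_freq.
rewrite lee_fin sumr_const card_ord -[_ *+ n]mulr_natl le_eqVlt; apply/orP; left.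
by apply/eqP; field; rewrite gt_eqF.
Qed.

End draws.

(** * Choice of the contraction factor *)

Section rate.
Context {R : realType}.

Lemma exists_rate (M E : nat) (eta kap : R) : 0 < eta -> 0 < kap -> kap <= 2^-1 ->
  (0 < E)%N ->
  exists al : R, [/\ 0 < al < 1, 1 <= al ^+ M * (1 + eta), 1 - kap < al ^+ E &
    1 - kap < al].
Proof.
move=> eta0 kap0 kap2 E0.
(* Bernoulli's inequality will give [1 - de] as a lower bound for both powers. Half of [kap] makes
   the comparison with [1 - kap] strict, and [eta / (1 + eta)] is the value at which
   [(1 - de) * (1 + eta) = 1]. *)
pose de := Num.min (kap / 2) (eta / (1 + eta)).
have eta1 : 0 < 1 + eta by rewrite addr_gt0.
have de0 : 0 < de by rewrite lt_min !divr_gt0.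
have dek : de <= kap / 2 by rewrite ge_min lexx.
have dee : de <= eta / (1 + eta) by rewrite ge_min lexx orbT.
pose N : R := (M + E)%:R.
have N1 : 1 <= N by rewrite ler1n addn_gt0 E0 orbT.
have N0 : 0 < N := lt_le_trans ltr01 N1.
pose e := de / N.
have e0 : 0 < e by rewrite divr_gt0.
have ede : e <= de by rewrite ler_pdivrMr// ler_peMr// ltW.
have e1 : 0 <= e <= 1 by apply/andP; lra.
have pow k : (k <= M + E)%N -> 1 - de <= (1 - e) ^+ k.
  move=> kN; apply: le_trans (bernoulli_le k e1).
  rewrite lerD2l lerN2 /e mulrCA ler_piMr ?(ltW de0)//.
  by rewrite ler_pdivrMr// mul1r ler_nat.
have eE : 1 - kap < (1 - e) ^+ E.
  by apply: lt_le_trans (pow E (leq_addl _ _)); lra.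
exists (1 - e); split=> //.
- by apply/andP; lra.
- have h := pow M (leq_addr _ _).
  apply: (@le_trans _ _ ((1 - de) * (1 + eta))); last by rewrite ler_pM2r.
  apply: (@le_trans _ _ ((1 - eta / (1 + eta)) * (1 + eta))).
    by rewrite mulrBl divfK ?gt_eqF// mul1r addrK.
  by rewrite ler_pM2r// lerD2l lerN2.
- by lra.
Qed.

End rate.

(** * The rate *)

Theorem theorem2 (R : realType) (m p n : nat)
  (C : 'M[R]_(m, p)) (d : 'cV[R]_m)
  (f : 'I_n -> 'cV[R]_p -> R) (sigma L : 'I_n -> R)
  (caratheodory : bool)
  (disp : measure_display) (T : measurableType disp) (Pr : probability T R)
  (G : nat -> set (set T)) (xi : nat -> nat -> T -> 'I_n)
  (x : nat -> T -> 'cV[R]_p) (mu : nat -> T -> 'cV[R]_p -> R)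
  (pv uv : nat -> T -> 'cV[R]_p) (gam : nat -> T -> R)
  (n_gt0 : (0 < n)%N)
  (cptP : compact (polyhedron C d))
  (nontrivP : exists y z, [/\ polyhedron C d y, polyhedron C d z & y != z])
  (sigma_gt0 : forall i, 0 < sigma i)
  (f_sc : forall i, strongly_convex (sigma i) (f i))
  (f_diff : forall i (y : 'cV[R]_p), differentiable (f i) y)
  (f_lip : forall i, lipschitz_grad (L i) (f i))
  (run : psfw C d f sigma L caratheodory Pr G xi x mu pv uv gam) :
  exists C3 phi : R,
    [/\ 0 < phi,
        phi < kappa C d sigma L caratheodory,
        kappa C d sigma L caratheodory <= 2^-1 &
        forall k : nat, (0 < k)%N ->
          ('E_Pr[(fun t => objective f (x k.+1 t) - optimum C d f)%R] <=
           ((C3 * (1 - phi) `^ (k%:R / (3 * (nb_vertices C d)`!%:R + 1)))%R)%:E)%E].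
Proof.
have [[filt adapt unif indep] x1 mu1 steps] := run.
(* Total mass 1 provides an outcome, whose starting point is the vertex required by the geometric
   lemmas. *)
have [t0 _] : exists t : T, True.
  apply: contrapT => noT.
  have T0 : [set: T] = set0 by apply/seteqP; split => // t _; case: noT; exists t.
  have := @probability_setT _ _ _ Pr; rewrite T0 measure0 => /eqP.
  by rewrite eqe eq_sym oner_eq0.
have vertex_ex : exists v, vertices C d v by exists (x 1%N t0).
pose kap := kappa C d sigma L caratheodory.
have kap0 : 0 < kap by exact: kappa_gt0.
have kap2 : kap <= 2^-1 by exact: kappa_le2V.
have [B B0 hB] :=
  function_grad_bound cptP nontrivP vertex_ex sigma_gt0 f_sc f_diff f_lip.
have s0 := sigmaF_gt0 n_gt0 sigma_gt0.
have l0 := LF_gt0 n_gt0 nontrivP sigma_gt0 f_sc f_diff f_lip.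
have D0 := diameter_gt0 cptP nontrivP.
set V := fset_set (vertices C d).
pose bs := batch_size C d sigma L caratheodory.
have bs0 k : (0 < bs k)%N by have [] := batch_size_bound C d sigma L caratheodory k.
(* [W k] and [h k] belong to iteration [k.+1], so [h k] is the quantity bounded in the conclusion
   for [k]. *)
pose W k t := noise (R := R) (bs k.+1) (fun j => xi k.+1 j t).
pose h k t := objective f (x k.+1 t) - optimum C d f.
have [eta [Cn [eta0 Cn0 contraction]]] : exists eta Cn : R, [/\ 0 < eta, 0 <= Cn &
    forall t k, (1 + eta) * h (k + (size V).+1)%N t <=
      h k t + Cn * \sum_(k <= j < k + (size V).+1) W j t].
  have A0 := gap_constant_gt0 n_gt0 cptP nontrivP vertex_ex sigma_gt0 B0.
  do 2 eexists; split; last first.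
    move=> t k; rewrite /h /W.
    apply: (@run_contraction R m p n C d f sigma L caratheodory n_gt0 cptP nontrivP
      vertex_ex sigma_gt0 f_sc f_diff f_lip B B0 hB (fun k => x k.+1 t)
      (fun k => mu k.+1 t) (fun k => pv k.+1 t) (fun k => uv k.+1 t)
      (fun k => gam k.+1 t) (fun k => bs k.+1) (fun k j => xi k.+1 j t)) => //.
      by move=> v Vv; exact: mu1.
    by move=> j; exact: steps.
  - have B2 : 0 <= 2 * B by rewrite mulr_ge0// ltW.
    apply: addr_ge0; [apply: addr_ge0; [apply: addr_ge0 => //|]|].
    + apply: mulr_ge0 => //; rewrite ltW// invr_gt0.
      by rewrite !mulr_gt0 ?exprn_gt0.
    + by rewrite ltW// invr_gt0 !mulr_gt0 ?exprn_gt0.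
    + by rewrite divr_ge0 ?sqr_ge0// mulr_ge0// ltW.
  - by rewrite invr_gt0 !mulr_gt0 ?exprn_gt0.
have h_bound t k : 0 <= h k t <= 2 * B.
  have Px : polyhedron C d (x k.+1 t).
    apply: (@run_polyhedron R m p n C d f sigma L caratheodory cptP nontrivP
      sigma_gt0 f_sc f_diff f_lip (fun k => x k.+1 t)
      (fun k => mu k.+1 t) (fun k => pv k.+1 t) (fun k => uv k.+1 t)
      (fun k => gam k.+1 t) (fun k => bs k.+1) (fun k j => xi k.+1 j t)) => //.
      by move=> v Vv; exact: mu1.
    by move=> j; exact: steps.
  have := objective_bound n_gt0 hB Px; rewrite ler_norml => /andP[_ o1].
  have o2 : - B <= optimum C d f.
    apply: le_optimum => // y Py.
    by have := objective_bound n_gt0 hB Py; rewrite ler_norml => /andP[].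
  rewrite /h subr_ge0 (optimum_le n_gt0 hB Px)/=.
  have -> : 2 * B = B - - B by ring.
  exact: lerB.
(* With [1 - phi = al ^+ E], the claimed power of [1 - phi] is exactly [al ^+ k]; the bound
   [phi < kappa] becomes [1 - kap < al ^+ E]. *)
pose E := (3 * (nb_vertices C d)`! + 1)%N.
have E0 : (0 < E)%N by rewrite /E addn1.
have [al [/andP[al0 al1] alM alE alk]] := exists_rate (size V).+1 eta0 kap0 kap2 E0.
pose H := 2 * B / al ^+ (size V).+1.
have H0 : 0 <= H by rewrite divr_ge0 ?mulr_ge0 ?exprn_ge0 ?(ltW B0) ?(ltW al0).
have unroll t k : h k t <= al ^+ k * (H + Cn * \sum_(0 <= j < k) al ^- j * W j t).
  apply: (@geometric_unroll R (fun k => h k t) (fun k => W k t) (size V).+1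
    H Cn eta) => //.
  - exact: ltW.
  - by move=> j; exact: noise_ge0.
  - by move=> j; rewrite /H mulrC divfK// gt_eqF// exprn_gt0.
have kap1 : 0 <= 1 - kap.
  by rewrite subr_ge0 (le_trans kap2)// invf_le1// ler1n.
(* Expected noise decays faster than [al ^+ j], so the weighted noise sum is dominated by a
   convergent geometric series of ratio [r]. *)
pose r := (1 - kap) / al.
have r01 : 0 <= r < 1.
  by rewrite divr_ge0 ?(ltW al0)//= ltr_pdivrMr// mul1r.
pose C3 := H + Cn * n%:R * (1 - r)^-1.
exists C3, (1 - al ^+ E); split => //.
- by rewrite subr_gt0 exprn_ilt1 ?(ltW al0)// -lt0n.
- by rewrite -/kap ltrBlDr -ltrBlDl.
move=> k k0.
have -> : (1 - (1 - al ^+ E)) `^ (k%:R / (3 * (nb_vertices C d)`!%:R + 1)) = al ^+ k.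
  have -> : 3 * (nb_vertices C d)`!%:R + 1 = E%:R :> R by rewrite natrD natrM.
  rewrite opprB addrC subrK -powR_mulrn ?(ltW al0)// -powRrM mulrCA divff ?mulr1.
    by rewrite powR_mulrn// ltW.
  by rewrite pnatr_eq0 -lt0n.
pose lam j := n%:R * (1 - kap) ^+ j.+2.
pose Y j t := noise_majorant C d sigma L caratheodory xi j.+1 t : R.
(* [Q] replaces the noise in the unrolled bound by its measurable majorant, so that its expectation
   can be taken term by term. *)
pose Q t := al ^+ k * H +
  \sum_(0 <= j < k) (al ^+ k * Cn * al ^- j) * Y j t.
apply: (@le_trans _ _ ('E_Pr[Q])%E).
  apply: expectation_le_pointwise => t; have /andP[-> _]/= := h_bound t k.
  apply: le_trans (unroll t k) _; rewrite mulrDr lerD2l mulrA mulr_sumr.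
  apply: ler_sum => j _; rewrite mulrA ler_wpM2l//.
    by rewrite !mulr_ge0 ?invr_ge0 ?exprn_ge0 ?(ltW al0).
  exact: noise_le_majorant.
apply: le_trans (expectation_affine_le _ (y := lam) _ _ _ _ _) _.
- by rewrite mulr_ge0 ?exprn_ge0 ?(ltW al0).
- by move=> j; rewrite !mulr_ge0 ?invr_ge0 ?exprn_ge0 ?(ltW al0).
- by move=> j; exact: measurable_noise_majorant filt adapt _ _.
- by move=> j t; exact: noise_majorant_ge0.
- by move=> j; exact: expectation_noise_majorant filt adapt unif indep _ _.
rewrite lee_fin /C3 mulrDl; apply: lerD; first by rewrite mulrC.
apply: (@le_trans _ _ (\sum_(0 <= j < k) al ^+ k * (Cn * n%:R) * r ^+ j)).
  apply: ler_sum => j _.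
  have -> : al ^+ k * Cn * al ^- j * lam j =
    al ^+ k * (Cn * n%:R) * (al ^- j * (1 - kap) ^+ j.+2) by rewrite /lam; ring.
  rewrite ler_wpM2l ?mulr_ge0 ?exprn_ge0 ?(ltW al0)//.
  rewrite /r expr_div_n mulrC ler_wpM2r ?invr_ge0 ?exprn_ge0 ?(ltW al0)//.
  (* Two spare factors [1 - kap] of [lam j] are dropped. *)
  by apply: ler_wiXn2l => //; [rewrite gerBl ltW | rewrite ltnW].
rewrite -mulr_sumr [leRHS]mulrC [leRHS]mulrA.
rewrite ler_wpM2l ?mulr_ge0 ?exprn_ge0 ?(ltW al0)//.
exact: sum_geometric_le.
Qed.
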